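(* Let $G$ be a Carnot group with homogeneous dimension $n\ge 3$, and let $N$, $\nabla_G$ and $|\cdot|$ be respectively the homogeneous norm built from the fundamental solution of the sub-Laplacian, the horizontal gradient, and the Carnot-Caratheodory distance to the neutral element, as defined in the context. Then for all $\alpha>2-n$ and all $s\in(0,1)$ there exists a constant $C>0$ such that, for all $u\in\mathcal D(G\setminus\{0\})$, $$\int_G u^2(x)\left(\frac{|\nabla_G N(x)|}{|N(x)|}\right)^{s}N^{\alpha}(x)\,dx\;\le\; C\iint_{G\times G}\frac{|u(x)-u(y)|^2}{|y^{-1}x|^{n+s}}\,N^{\alpha}(x)\,dx\,dy .$$ (The right-hand side may be $+\infty$; $C$ does not depend on $u$.)
   Context: A Carnot group is a simply connected Lie group $G$ whose Lie algebra $\mathcal G$ admits a stratification: there are linear subspaces $V_1,\dots,V_m$ of $\mathcal G$ with $\mathcal G=V_1\oplus\cdots\oplus V_m$, $[V_1,V_i]=V_{i+1}$ for $i=1,\dots,m-1$, and $[V_1,V_m]=0$, where $[V_1,V_i]$ is the subspace generated by the elements $[X,Y]$ with $X\in V_1$, $Y\in V_i$. Such a group is nilpotent, hence unimodular; $dx$ denotes its (bi-invariant) Haar measure. Let $\mathbb X=\{X_1,\dots,X_k\}$ be left-invariant vector fields on $G$ forming a basis of $V_1$; they satisfy the Hörmander condition, i.e. they generate $\mathcal G$ as a Lie algebra. Put $\nabla_G=(X_1,\dots,X_k)$, $|\nabla_G f|=\left(\sum_{i=1}^k|X_if|^2\right)^{1/2}$ and $\Delta_G=\sum_{i=1}^kX_i^2$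 (so $-\Delta_G=-\sum_{i=1}^k X_i^2$). Carnot-Caratheodory distance: an absolutely continuous path $\ell:[0,1]\to G$ is admissible if there are measurable functions $a_1,\dots,a_k:[0,1]\to\mathbb C$ with $\ell'(t)=\sum_{i=1}^k a_i(t)X_i(\ell(t))$ for almost every $t$; its length is $|\ell|=\int_0^1\left(\sum_{i=1}^k|a_i(t)|^2\right)^{1/2}dt$. The distance $d(x,y)$ is the infimum of the lengths of admissible paths joining $x$ to $y$. It is left-invariant. Write $|x|=d(e,x)$, with $e$ the neutral element, so that $d(x,y)=|y^{-1}x|$. Let $V(r)$ be the Haar measure of any ball of radius $r$. The homogeneous dimension is the integer $n$ such that there is $c>0$ with $c^{-1}r^n\le V(r)\le c\,r^n$ for all $r>0$. Let $0$ denote the neutral element (origin) of $G$ and $\delta$ the Dirac distribution at $0$. Let $\Gamma$ be the fundamental solution of $-\Delta_G$, i.e. the solution of $-\Delta_G\Gamma=\delta$ that is positive on $G\setminus\{0\}$, smooth there, and homogeneous of degree $2-n$ under the group dilations. Define $N(x)=\Gamma(x)^{1/(2-n)}$ for $x\ne0$ and $N(0)=0$; $N$ is a homogeneous norm on $G$. $\mathcal D(G\setminus\{0\})$ is the space of smooth (real-valued) functions with compact support in $G\setminus\{0\}$. *)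

(* Defs.v *)
From HB Require Import structures.
From mathcomp Require Import all_boot all_order all_algebra.
From mathcomp Require Import complex.
From mathcomp Require Import all_classical all_reals all_analysis.

Set Implicit Arguments.
Unset Strict Implicit.
Unset Printing Implicit Defensive.

Import Order.TTheory GRing.Theory Num.Theory.
Import numFieldNormedType.Exports.
Import ComplexField.

Local Open Scope classical_set_scope.
Local Open Scope ring_scope.
Local Open Scope complex_scope.

(* The base point is only there because measurable types are pointed; it plays
   no role.  Continuity of the operations is part of [lie_group] below. *)
#[short(type="ptopGroupType")]
HB.structure Definition PTopGroup := {G of PointedTopological G & Group G}.

Section Smoothness.
Variables (R : realType) (E F : normedModType R).

(* [U] is meant to be open and [E] finite-dimensional. *)
Fixpoint Ck (k : nat) (U : set E) (f : E -> F) : Prop :=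
  (forall x, U x -> {for x, continuous f}) /\
  (if k is k'.+1 then
     forall v : E, (forall x, U x -> derivable f x v) /\
                   Ck k' U (fun x => 'D_v f x)
   else True).

Definition Cinf (U : set E) (f : E -> F) : Prop := forall k, Ck k U f.

End Smoothness.

Definition abs_cont (R : realType) (a b : R) (f : R -> R) : Prop :=
  forall e : R, 0 < e -> exists2 r : R, 0 < r &
    forall (p : nat) (x y : 'I_p -> R),
      (forall i, a <= x i /\ x i <= y i /\ y i <= b) ->
      (forall i j, i != j -> y i <= x j \/ y j <= x i) ->
      \sum_(i < p) (y i - x i) < r ->
      \sum_(i < p) `|f (y i) - f (x i)| < e.

Section LieGroups.
Variables (R : realType) (d : nat) (G : ptopGroupType).
Implicit Types (U W : set G) (f : G -> R).

(* [chart_inv] is only meaningful on the image of [chart_dom]. *)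
Record chart := Chart {
  chart_dom : set G ;
  chart_map : G -> 'rV[R]_d ;
  chart_inv : 'rV[R]_d -> G }.

Definition chart_im (c : chart) (W : set G) : set 'rV[R]_d :=
  chart_map c @` (chart_dom c `&` W).

Record is_chart (c : chart) : Prop := IsChart {
  chart_dom_open : open (chart_dom c) ;
  chart_im_open : open (chart_im c setT) ;
  chart_mapK : forall x, chart_dom c x -> chart_inv c (chart_map c x) = x ;
  chart_map_cont :
    forall x, chart_dom c x -> {for x, continuous (chart_map c)} ;
  chart_inv_cont :
    forall p, chart_im c setT p -> {for p, continuous (chart_inv c)} }.

Variable A : set chart.

Definition smooth_map (h : G -> G) : Prop :=
  continuous h /\
  forall c1 c2, A c1 -> A c2 ->
    Cinf (chart_im c1 (h @^-1` chart_dom c2))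
         (fun p => chart_map c2 (h (chart_inv c1 p))).

Definition smooth_map2 (h : G -> G -> G) : Prop :=
  continuous (fun z : G * G => h z.1 z.2) /\
  forall c1 c2 c3, A c1 -> A c2 -> A c3 ->
    Cinf [set z : 'rV[R]_d * 'rV[R]_d |
            [/\ chart_im c1 setT z.1, chart_im c2 setT z.2 &
                chart_dom c3 (h (chart_inv c1 z.1) (chart_inv c2 z.2))]]
         (fun z => chart_map c3 (h (chart_inv c1 z.1) (chart_inv c2 z.2))).

(* Smooth real functions on an open subset [W] of [G]. *)
Definition smooth_on W f : Prop :=
  forall c, A c -> Cinf (chart_im c W) (fun p => f (chart_inv c p)).

Record lie_group : Prop := LieGroup {
  lie_hausdorff : hausdorff_space G ;
  lie_second_countable : second_countable (T := G) ;
  lie_charts : forall c, A c -> is_chart c ;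
  lie_cover : forall x : G, exists2 c, A c & chart_dom c x ;
  lie_compatible : forall c1 c2, A c1 -> A c2 ->
    Cinf (chart_im c1 (chart_dom c2))
         (fun p => chart_map c2 (chart_inv c1 p)) ;
  lie_mul : smooth_map2 (fun x y : G => (x * y)%g) ;
  lie_inv : smooth_map (fun x : G => (x^-1)%g) }.

Definition simply_connected : Prop :=
  (forall x y : G, exists g : R -> G,
     [/\ {within `[0, 1], continuous g}, g 0 = x & g 1 = y]) /\
  (forall g : R -> G, {within `[0, 1], continuous g} -> g 0 = g 1 ->
     exists H : R * R -> G,
       [/\ {within `[0, 1] `*` `[0, 1], continuous H},
           forall t : R, t \in `[0, 1] -> H (0, t) = g t,
           forall t : R, t \in `[0, 1] -> H (1, t) = g 0 &
           forall s : R, s \in `[0, 1] -> H (s, 0) = g 0 /\ H (s, 1) = g 0]).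

(* [c0] is a chart around the neutral element.  It identifies the tangent space
   at the neutral element, hence the Lie algebra of left-invariant vector
   fields, with ['rV[R]_d]: the field associated with [v] has at [x] the value
   d(L_x)_1(v), where L_x is the left translation by [x]. *)
Variable c0 : chart.

Definition lfield (v : 'rV[R]_d) f (x : G) : R :=
  'D_v (fun p => f (x * chart_inv c0 p)%g) (chart_map c0 1%g).

(* The commutator of two left-invariant vector fields is the left-invariant
   field of a unique vector, which [xget] selects. *)
Definition lie_bracket (v w : 'rV[R]_d) : 'rV[R]_d :=
  xget 0 [set z | forall f, smooth_on setT f -> forall x,
    lfield z f x = lfield v (lfield w f) x - lfield w (lfield v f) x].

(* [S] is the linear subspace generated by the [v, w], v in U and w in W. *)
Definition is_bracket_span (U W S : {vspace 'rV[R]_d}) : Prop :=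
  let contains (T : {vspace 'rV[R]_d}) :=
    forall v w, v \in U -> w \in W -> lie_bracket v w \in T in
  contains S /\ forall T, contains T -> (S <= T)%VS.

(* The layers are V 1, ..., V m; the other values of [V] are irrelevant. *)
Record stratification (m : nat) (V : nat -> {vspace 'rV[R]_d}) : Prop :=
  Stratification {
    strat_pos : (0 < m)%N ;
    strat_sum : (\sum_(j < m) V j.+1)%VS = fullv ;
    strat_direct : directv (\sum_(j < m) V j.+1)%VS ;
    strat_step : forall i, (0 < i < m)%N ->
      is_bracket_span (V 1%N) (V i) (V i.+1) ;
    strat_last : is_bracket_span (V 1%N) (V m) 0%VS }.

(* The dilation of ratio [r] is the automorphism whose differential at the
   neutral element is multiplication by r ^ j on V j. *)
Record dilations (m : nat) (V : nat -> {vspace 'rV[R]_d})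
    (delta : R -> G -> G) : Prop := Dilations {
  dil_smooth : forall r : R, 0 < r -> smooth_map (delta r) ;
  dil_morph : forall r : R, 0 < r -> forall x y,
    delta r (x * y)%g = (delta r x * delta r y)%g ;
  dil_1 : forall x, delta 1 x = x ;
  dil_M : forall r s : R, 0 < r -> 0 < s -> forall x,
    delta (r * s) x = delta r (delta s x) ;
  dil_diff : forall r : R, 0 < r -> forall j, (0 < j <= m)%N ->
    forall v, v \in V j -> forall W f x, open W -> smooth_on W f ->
      W (delta r x) ->
      lfield v (fun y => f (delta r y)) x = r ^+ j * lfield v f (delta r x) }.

Section Horizontal.
Variables (k : nat) (X : k.-tuple 'rV[R]_d).

Definition hgrad_norm f (x : G) : R :=
  Num.sqrt (\sum_(i < k) `|lfield (tnth X i) f x| ^+ 2).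

Definition sublap f (x : G) : R :=
  \sum_(i < k) lfield (tnth X i) (lfield (tnth X i) f) x.

(* Absolute continuity and the velocity of a path are tested against the
   locally defined smooth functions, in particular the chart coordinates. *)
Definition abs_cont_path (l : R -> G) : Prop :=
  {within `[0, 1], continuous l} /\
  forall (a b : R) W f, 0 <= a -> a <= b -> b <= 1 -> open W ->
    (forall t, t \in `[a, b] -> W (l t)) -> smooth_on W f ->
    abs_cont a b (fun t => f (l t)).

Definition admissible (l : R -> G) (a : 'I_k -> R -> R[i]) : Prop :=
  [/\ abs_cont_path l,
      forall i, measurable_fun (`[0, 1] : set R) (fun t => complex.Re (a i t)) /\
                measurable_fun (`[0, 1] : set R) (fun t => complex.Im (a i t)) &
      {ae @lebesgue_measure R, forall t : R, t \in `[0, 1] ->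
         forall W f, open W -> W (l t) -> smooth_on W f ->
           derivable (fun s => f (l s)) t 1 /\
           ('D_1 (fun s => f (l s)) t)%:C =
             \sum_(i < k) a i t * (lfield (tnth X i) f (l t))%:C}].

Definition path_length (a : 'I_k -> R -> R[i]) : \bar R :=
  (\int[@lebesgue_measure R]_(t in `[0%R, 1%R])
     (Num.sqrt (\sum_(i < k) Normc.normc (a i t) ^+ 2))%:E)%E.

Definition cc_dist (x y : G) : \bar R :=
  ereal_inf [set L | exists l a,
    [/\ admissible l a, l 0 = x, l 1 = y & L = path_length a]].

(* [cc_dist] is finite under the bracket-generating condition, so nothing is
   lost by taking [fine]. *)
Definition cc_norm (x : G) : R := fine (cc_dist 1%g x).

Definition cc_ball (x : G) (r : R) : set G := [set y | (cc_dist x y < r%:E)%E].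

End Horizontal.

Local Notation borelType := (g_sigma_algebraType (@open G)).

Definition compactly_supported f : Prop := compact (closure [set x | f x != 0]).

Definition test_fun f : Prop := smooth_on setT f /\ compactly_supported f.

Definition test_fun_off1 f : Prop :=
  test_fun f /\ ~ closure [set x | f x != 0] 1%g.

Section Measure.
Variable mu : {sigma_finite_measure set borelType -> \bar R}.

(* Bi-invariant Radon measure, positive on nonempty open sets. *)
Record haar_measure : Prop := HaarMeasure {
  haar_left : forall (g : G) (B : set borelType), measurable B ->
    mu [set x : G | B (g * x)%g] = mu B ;
  haar_right : forall (g : G) (B : set borelType), measurable B ->
    mu [set x : G | B (x * g)%g] = mu B ;
  haar_pos : forall U, open U -> U !=set0 -> (0 < mu U)%E ;
  haar_compact : forall K : set G, compact K -> (mu K < +oo)%E ;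
  haar_outer : forall B : set borelType, measurable B ->
    mu B = ereal_inf [set mu U | U in [set U : set G | open U /\ B `<=` U]] ;
  haar_inner : forall U, open U ->
    mu U = ereal_sup [set mu K | K in [set K : set G | compact K /\ K `<=` U]] }.

Definition homogeneous_dimension k (X : k.-tuple 'rV[R]_d) (n : nat) : Prop :=
  exists2 c : R, 0 < c & forall r : R, 0 < r ->
    [/\ measurable (cc_ball X 1%g r : set borelType),
        ((c^-1 * r ^+ n)%:E <= mu (cc_ball X 1%g r))%E &
        (mu (cc_ball X 1%g r) <= (c * r ^+ n)%:E)%E].

(* [fs_eq] is the equation - Delta_G Gamma = delta in the sense of
   distributions; Delta_G is formally self-adjoint. *)
Record fundamental_solution k (X : k.-tuple 'rV[R]_d) (delta : R -> G -> G)
    (n : nat) (Gamma : G -> R) : Prop := FundamentalSolution {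
  fs_pos : forall x : G, x != 1%g -> 0 < Gamma x ;
  fs_smooth : smooth_on (~` [set 1%g]) Gamma ;
  fs_homog : forall (r : R) (x : G), 0 < r -> x != 1%g ->
    Gamma (delta r x) = r `^ (2 - n%:R) * Gamma x ;
  fs_loc_int : forall K : set borelType, compact (K : set G) ->
    mu.-integrable K (fun x : borelType => (Gamma x)%:E) ;
  fs_eq : forall phi, test_fun phi ->
    (\int[mu]_x (Gamma x * - sublap X phi x)%:E = (phi 1%g)%:E)%E }.

End Measure.

Definition hom_norm (n : nat) (Gamma : G -> R) (x : G) : R :=
  if x == 1%g then 0 else Gamma x `^ (2 - n%:R)^-1.

End LieGroups.

Notation borelType G := (g_sigma_algebraType (@open G)).

(* Main.v *)
From HB Require Import structures.
Require Import Defs.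
From mathcomp Require Import all_boot all_order all_algebra.
From mathcomp Require Import complex.
From mathcomp Require Import all_classical all_reals all_analysis.
From mathcomp Require Import measurable_realfun ring lra.

Set Implicit Arguments.
Unset Strict Implicit.
Unset Printing Implicit Defensive.

Import Order.TTheory GRing.Theory Num.Theory.
Import numFieldNormedType.Exports.

Local Open Scope classical_set_scope.
Local Open Scope ring_scope.

(** Since N is homogeneous of degree 1 and its horizontal gradient of degree
    0, the quotient |grad N| / |N| is bounded by a multiple of 1 / rho, where
    rho(x) = d(e, x) is the Carnot-Caratheodory gauge, and N is comparable with
    rho.  Everything thus reduces to the fractional Hardy inequality
      int u^2 rho^(alpha - s)
        <= C iint |u(x) - u(y)|^2 / rho(y^-1 x)^(n + s) rho(x)^alpha.
    Put a = alpha - s, so that n + a > 2 - s > 0.  The inequality comes from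
    comparing u(x) with u(y) for y in a much farther shell:
      T = { (x, y) : la rho(x) <= rho(y) < La rho(x) }.
    Integrate u(x)^2 <= 2 u(y)^2 + 2 |u(x) - u(y)|^2 over T against the weight
    rho(x)^(a - n), and write J for int u^2 rho^a.  The ball of radius r has a
    volume comparable with r^n, so by Tonelli's theorem the left hand side is at
    least la^n J, whereas the term in u(y)^2 is at most a constant times
    la^(- a) J.  As n + a > 0, for la large the latter is absorbed by the
    former ([annular_hardy]).  On T one has rho(y^-1 x) <= (1 + La) rho(x),
    which bounds the remaining term by the double integral of the theorem.

    The comparison of N with rho rests on the fact that the unit sphere of rho
    lies in a compact set that avoids the neutral element; there Gamma is
    bounded above and below, its horizontal derivatives are bounded, and
    homogeneity does the rest ([hom_norm_bounds]).  The required topology is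
    extracted from the volume of the balls.  The ball of radius r / 2 has
    positive measure, so by the theorem of Steinhaus ([steinhaus]) the ball of
    radius r is a neighbourhood of the neutral element.  Connectedness of the
    group then makes rho finite ([ccd_finite]), and since a ball of finite
    measure contains only finitely many disjoint translates of a small open set
    ([packing]), balls are relatively compact.  The points where rho = 0 form a
    null set, being contained in balls of arbitrarily small volume.

    The triangle inequality, the homogeneity and the left invariance of rho are
    proved on paths.  The last two are instances of one fact: a smooth map that
    multiplies the horizontal fields by a constant carries admissible paths to
    admissible paths ([seg_push]).  It needs the composition of a smooth function
    with a smooth map to be smooth in the sense of iterated directional
    derivatives ([Ck_comp]). *)

(** * Calculus of iterated directional derivatives *)

Section CkTheory.
Variable R : realType.

Lemma CkW (E F : normedModType R) k U (f : E -> F) :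
  Ck k.+1 U f -> Ck k U f.
Proof.
elim: k f => [|k IH] f [fc H]; first by split.
by split=> // v; have [d Hd] := H v; split=> //; exact: IH.
Qed.

Lemma Ck_le (E F : normedModType R) k l U (f : E -> F) :
  (k <= l)%N -> Ck l U f -> Ck k U f.
Proof.
elim: l => [|l IH]; first by rewrite leqn0 => /eqP ->.
by rewrite leq_eqVlt ltnS => /predU1P[->//|kl /CkW]; exact: IH.
Qed.

Lemma Ck_continuous (E F : normedModType R) k U (f : E -> F) x :
  Ck k U f -> U x -> {for x, continuous f}.
Proof. by case: k => [|k] [+ _] Ux; apply. Qed.

(** The derivatives at a point see only a neighbourhood of it, so
    differentiability up to order k can be checked on any cover, open or not.
    This is how smoothness in one chart is combined from several charts. *)
Lemma Ck_local (E F : normedModType R) k (U : set E) (f : E -> F) :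
  (forall x, U x -> exists2 W : set E, W x & Ck k W f) -> Ck k U f.
Proof.
elim: k f => [|k IH] f H.
  by split=> // x /H[W Wx] fW; exact: (Ck_continuous fW Wx).
split; first by move=> x /H[W Wx] fW; exact: (Ck_continuous fW Wx).
move=> v; split.
  by move=> x /H[W Wx [_ /(_ v)[dW _]]]; exact: dW.
by apply: IH => x /H[W Wx [_ /(_ v)[_ ?]]]; exists W.
Qed.

Lemma Ck_sub (E F : normedModType R) k (U W : set E) (f : E -> F) :
  W `<=` U -> Ck k U f -> Ck k W f.
Proof. by move=> WU fU; apply: Ck_local => x /WU Ux; exists U. Qed.

Lemma Ck_eq (E F : normedModType R) k (U : set E) (f g : E -> F) :
  open U -> (forall x, U x -> f x = g x) -> Ck k U f -> Ck k U g.
Proof.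
move=> oU.
have nfg (h1 h2 : E -> F) : (forall x, U x -> h1 x = h2 x) ->
    forall x, U x -> \forall y \near x, h1 y = h2 y.
  by move=> h12 x Ux; near=> y; apply: h12; near: y; exact: open_nbhs_nbhs.
have ctn (h1 h2 : E -> F) : (forall x, U x -> h1 x = h2 x) ->
    (forall x, U x -> {for x, continuous h1}) ->
    forall x, U x -> {for x, continuous h2}.
  move=> h12 h1c x Ux; rewrite /prop_for /continuous_at -h12//.
  by apply: cvg_trans (h1c x Ux); apply: near_eq_cvg; exact: nfg.
elim: k f g => [|k IH] f g fg [fc H].
  by split=> //; exact: ctn fc.
split; first exact: ctn fc.
move=> v; have [dv Hv] := H v; split.
  by move=> x Ux; apply: near_eq_derivable (dv x Ux); exact: nfg.
by apply: IH Hv => x Ux; apply: near_eq_derive; exact: nfg.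
Unshelve. all: by end_near. Qed.

Lemma CkD (E : normedModType R) k (U : set E) (f g : E -> R) :
  open U -> Ck k U f -> Ck k U g -> Ck k U (fun x => f x + g x).
Proof.
move=> oU; elim: k f g => [|k IH] f g [fc Hf] [gc Hg].
  by split=> // x Ux; apply: cvgD; [exact: fc|exact: gc].
split; first by move=> x Ux; apply: cvgD; [exact: fc|exact: gc].
move=> v; have [df Hfv] := Hf v; have [dg Hgv] := Hg v; split.
  by move=> x Ux; apply: derivableD; [exact: df|exact: dg].
apply: Ck_eq (IH _ _ Hfv Hgv) => // x Ux.
by rewrite -deriveD//; [exact: df|exact: dg].
Qed.

Lemma CkM (E : normedModType R) k (U : set E) (f g : E -> R) :
  open U -> Ck k U f -> Ck k U g -> Ck k U (fun x => f x * g x).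
Proof.
move=> oU; elim: k f g => [|k IH] f g Hf Hg.
  by split=> // x Ux; apply: cvgM; [exact: Hf.1|exact: Hg.1].
split; first by move=> x Ux; apply: cvgM; [exact: Hf.1|exact: Hg.1].
move=> v; have [df Hfv] := Hf.2 v; have [dg Hgv] := Hg.2 v; split.
  by move=> x Ux; apply: derivableM; [exact: df|exact: dg].
have H1 := IH _ _ (CkW Hf) Hgv; have H2 := IH _ _ (CkW Hg) Hfv.
apply: Ck_eq (CkD oU H1 H2) => // x Ux.
by rewrite -[RHS]/('D_v (f * g) x) deriveM//; [exact: df|exact: dg].
Qed.

Lemma Ck_cst (E : normedModType R) k (U : set E) (c : R) :
  Ck k U (fun=> c).
Proof.
elim: k c => [|k IH] c; first by split=> // x _; exact: cvg_cst.
split=> [x _|v]; first exact: cvg_cst.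
split; first by move=> x _; exact: derivable_cst.
rewrite [X in Ck _ _ X](_ : _ = fun=> 0); first exact: IH.
by apply/funext => x; exact: derive_cst.
Qed.

Lemma Ck_sum (E : normedModType R) k (U : set E) n (f : 'I_n -> E -> R) :
  open U -> (forall i, Ck k U (f i)) -> Ck k U (fun x => \sum_i f i x).
Proof.
move=> oU; elim: n f => [|n IH] f fC.
  by under eq_fun do rewrite big_ord0; exact: Ck_cst.
by under eq_fun do rewrite big_ord_recl; apply: CkD => //; apply: IH.
Qed.

Lemma Ck_coord (E : normedModType R) k (U : set E) m n (f : E -> 'M[R]_(m, n)) i j :
  open U -> Ck k U f -> Ck k U (fun x => f x i j).
Proof.
move=> oU; elim: k f => [|k IH] f [fc Hf].
  split=> // x Ux;
    by apply: (@continuous_comp _ _ _ f (fun M : 'M[R]_(m, n) => M i j));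
      [exact: fc|exact: coord_continuous].
split; first by move=> x Ux;
    by apply: (@continuous_comp _ _ _ f (fun M : 'M[R]_(m, n) => M i j));
      [exact: fc|exact: coord_continuous].
move=> v; have [df Hfv] := Hf v; split.
  by move=> x Ux; exact: (derivable_mxP _ _ _).1 (df x Ux) i j.
by apply: Ck_eq (IH _ Hfv) => // x Ux; rewrite derive_mx ?mxE//; exact: df.
Qed.

(** The mean value theorem for the function c |-> g (c *: e + y) of one
    variable, on the segment from 0 to t, whichever the sign of t. *)
Lemma MVT_dir (E : normedModType R) (g : E -> R) (y e : E) (t : R) :
  (forall c, `|c| <= `|t| -> derivable g (c *: e + y) e) ->
  exists2 c, `|c| <= `|t| & g (t *: e + y) - g y = t * 'D_e g (c *: e + y).
Proof.
move=> dg; pose f (s : R) := g (s *: e + y).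
have df c : `|c| <= `|t| -> is_derive c (1 : R) f ('D_e g (c *: e + y)).
  move=> /dg dc; split.
    have := dc; rewrite /derivable /f.
    set g1 := (X in cvg (X @ _) -> _); set g2 := (X in _ -> cvg (X @ _)).
    suff -> : g1 = g2 by [].
    by apply/funext => h; rewrite /g1 /g2 /= [_%:A]mulr1 scalerDl addrA.
  rewrite /derive; set g1 := (X in lim (X @ _) = _).
  set g2 := (X in _ = lim (X @ _)); suff -> : g1 = g2 by [].
  by apply/funext => h; rewrite /g1 /g2 /f /= [_%:A]mulr1 scalerDl addrA.
have [t0|t0] := leP 0 t.
  have [||c] := @MVT_segment R f (fun c => 'D_e g (c *: e + y)) 0 t t0.
  - by move=> c; rewrite in_itv/= => /andP[c0 ct]; apply: df;
       rewrite !ger0_norm// ltW.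
  - apply: derivable_within_continuous => c; rewrite in_itv/= => /andP[c0 ct].
    by have /df[] : `|c| <= `|t| by rewrite !ger0_norm.
  rewrite in_itv/= => /andP[c0 ct].
  rewrite /f scale0r add0r subr0 mulrC => ?; exists c => //.
  by rewrite !ger0_norm.
have [||c] := @MVT_segment R f (fun c => 'D_e g (c *: e + y)) t 0 (ltW t0).
- by move=> c; rewrite in_itv/= => /andP[c0 ct]; apply: df;
    rewrite !ler0_norm ?lerN2 ?ltW.
- apply: derivable_within_continuous => c; rewrite in_itv/= => /andP[c0 ct].
  by have /df[] : `|c| <= `|t| by rewrite !ler0_norm ?lerN2// ltW.
rewrite in_itv/= => /andP[c0 ct].
rewrite /f scale0r add0r sub0r mulrN -mulNr mulrC => H; exists c => //.
  by rewrite !ler0_norm ?lerN2// ltW.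
by rewrite -opprB H mulrN opprK.
Qed.

Lemma rV_norm_le d (v : 'rV[R]_d) (M : R) :
  0 <= M -> (forall i, `|v 0 i| <= M) -> `|v| <= M.
Proof.
move=> M0 vM; rewrite [leLHS]/Num.Def.normr/= mx_normrE bigmax_le//= => -[i j] _.
by rewrite ord1; exact: vM.
Qed.

Lemma rV_coord_le d (v : 'rV[R]_d) i : `|v 0 i| <= `|v|.
Proof.
rewrite [leRHS]/Num.Def.normr/= mx_normrE.
exact: (le_bigmax _ (fun ij : 'I_1 * 'I_d => `|v ij.1 ij.2|) (0, i)).
Qed.

(** Directional derivatives alone do not give a differential; continuous partial
    derivatives do.  The increment is telescoped along the coordinates: the
    point [tr j + y0] has the first j coordinates of h + y0 and the others of
    y0, each step moves one coordinate, and the mean value theorem turns it into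
    a partial derivative at a nearby point. *)
Lemma C1_increment d (g : 'rV[R]_d -> R) (U : set 'rV[R]_d) y0 :
  open U -> U y0 -> Ck 1 U g -> forall e : R, 0 < e ->
  \forall h \near (0 : 'rV[R]_d),
    `|g (h + y0) - g y0 - \sum_i h 0 i * 'D_('e_i) g y0| <= e * `|h|.
Proof.
move=> oU Uy0 [gc gD] e e0.
have d1 : 0 < d%:R + 1 :> R by rewrite ltr_wpDl.
have [r /= r0 rU] : exists2 r : R, 0 < r & forall y, `|y - y0| < r ->
    U y /\ forall i, `|'D_('e_i) g y - 'D_('e_i) g y0| <= e / (d%:R + 1).
  have Q : \forall y \near y0,
      U y /\ forall i : 'I_d, `|'D_('e_i) g y - 'D_('e_i) g y0| <= e / (d%:R + 1).
    apply: filterI; first exact: open_nbhs_nbhs.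
    apply: (@filter_forall _ 'I_d (fun i y => `|'D_'e_i g y - 'D_'e_i g y0| <= _)
      _ (nbhs_filter y0)) => i.
    have /cvgrPdist_le := (gD 'e_i).2.1 y0 Uy0.
    move=> /(_ (e / (d%:R + 1))); rewrite divr_gt0// => /(_ isT).
    by apply: filterS => y; rewrite distrC.
  move/nbhs_ballP : Q => [r r0 rQ]; exists r => // y yr; apply: rQ.
  by rewrite -ball_normE /ball_/= distrC.
near=> h.
have hr : `|h| < r.
  near: h; apply/nbhs_ballP; exists r => // y.
  by rewrite -ball_normE /ball_/= sub0r normrN.
pose tr j : 'rV[R]_d := \row_i (if (i < j)%N then h 0 i else 0).
have trS (j : 'I_d) : tr j.+1 = h 0 j *: 'e_j + tr j.
  apply/rowP => i; rewrite !mxE eqxx/= ltnS leq_eqVlt.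
  have [->|ij] := eqVneq i j; first by rewrite eqxx/= ltnn mulr1 addr0.
  rewrite (_ : (i == j :> nat) = false); last exact/eqP/eqP.
  by rewrite /= mulr0 add0r.
have trn (j : 'I_d) c : `|c| <= `|h 0 j| -> `|c *: 'e_j + tr j| <= `|h|.
  move=> cj; apply: rV_norm_le => // i; rewrite !mxE eqxx/=.
  have [->|ij] := eqVneq i j.
    by rewrite ltnn mulr1 addr0 (le_trans cj)// rV_coord_le.
  by rewrite mulr0 add0r; case: ifP; rewrite ?normr0// rV_coord_le.
have main j : (j <= d)%N ->
    `|g (tr j + y0) - g y0 - \sum_(i < d | (i < j)%N) h 0 i * 'D_('e_i) g y0|
    <= e / (d%:R + 1) * j%:R * `|h|.
  elim: j => [_|j IH jd].
    rewrite big_pred0// mulr0 mul0r subr0.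
    have -> : tr 0%N = 0 by apply/rowP => i; rewrite !mxE.
    by rewrite add0r subrr normr0.
  have {}IH := IH (ltnW jd).
  have [|c cj E] := @MVT_dir _ g (tr j + y0) 'e_(Ordinal jd) (h 0 (Ordinal jd)).
    move=> c cj; apply: (gD _).1; apply: (rU _ _).1.
    by rewrite addrA addrK (le_lt_trans (trn (Ordinal jd) c cj)).
  rewrite (bigD1 (Ordinal jd))//=.
  rewrite [X in _ - (_ + X)](_ : _ = \sum_(i < d | (i < j)%N) h 0 i * 'D_('e_i) g y0); last first.
    apply: eq_bigl => i; rewrite ltnS; have [->|ij] := eqVneq i (Ordinal jd).
      by rewrite /= ltnn andbF.
    by rewrite andbT [RHS]ltn_neqAle [X in _ = X && _]ij.
  rewrite -[j.+1]/(nat_of_ord (Ordinal jd)).+1 (trS (Ordinal jd)) -[_ *: _ + _ + y0]addrA /=.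
  set S := \sum_(i < d | _) _ in IH *; set t := h 0 _ in cj E *.
  rewrite (_ : _ - _ - _ = (g (tr j + y0) - g y0 - S) +
     t * ('D_('e_(Ordinal jd)) g (c *: 'e_(Ordinal jd) + (tr j + y0)) -
       'D_('e_(Ordinal jd)) g y0)); last first.
    by rewrite mulrBr -E; ring.
  have -> : e / (d%:R + 1) * j.+1%:R * `|h| =
      e / (d%:R + 1) * j%:R * `|h| + e / (d%:R + 1) * `|h|.
    by rewrite -[j.+1%:R]natr1; ring.
  apply: le_trans (ler_normD _ _) _; rewrite lerD//.
  rewrite normrM mulrC ler_pM//; last exact: rV_coord_le.
  apply: (rU _ _).2; rewrite addrA addrK.
  by rewrite (le_lt_trans (trn (Ordinal jd) c cj)).
have := main d (leqnn d).
have -> : tr d = h by apply/rowP => i; rewrite !mxE ltn_ord.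
have -> : \sum_(i < d | (i < d)%N) h 0 i * 'D_'e_i g y0 =
    \sum_i h 0 i * 'D_'e_i g y0 by apply: eq_bigl => i; rewrite ltn_ord.
move=> /le_trans; apply; rewrite ler_wpM2r//.
by rewrite mulrAC -mulrA ger_pMr// ler_pdivrMr// mul1r lerDl.
Unshelve. all: by end_near. Qed.

Lemma differentiable_expansion (E F : normedModType R) (f : E -> F)
    (df : {linear E -> F}) x :
  continuous df -> f \o shift x = cst (f x) + df +o_ 0 id ->
  differentiable f x /\ 'd f x = df :> (E -> F).
Proof.
move=> dfc fE; have dE := diff_unique dfc fE.
by split=> //; apply/diff_locallyP; rewrite dE.
Qed.

Lemma C1_differentiable d (g : 'rV[R]_d -> R) (U : set 'rV[R]_d) y0 :
  open U -> U y0 -> Ck 1 U g ->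
  differentiable g y0 /\
  forall h, 'd g y0 h = \sum_i h 0 i * 'D_('e_i) g y0.
Proof.
move=> oU Uy0 gC.
pose dg (h : 'rV[R]_d) := \sum_i h 0 i * 'D_('e_i) g y0.
have lin : linear dg.
  move=> a u v; rewrite /dg scaler_sumr -big_split/=; apply: eq_bigr => i _.
  by rewrite !mxE mulrDl -mulrA.
pose dgM := GRing.isLinear.Build _ _ _ _ dg lin.
pose dgL : {linear 'rV[R]_d -> R} := HB.pack dg dgM.
have dgc : continuous dgL.
  move=> h; apply: (@Ck_continuous _ _ 0 setT dg) => //.
  apply: Ck_sum => [|i]; first exact: openT.
  apply: CkM; [exact: openT| |exact: Ck_cst].
  by split=> // y _; exact: (@coord_continuous R 1 d 0 i y).
have [gd dE] : differentiable g y0 /\ 'd g y0 = dgL :> ('rV[R]_d -> R).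
  apply: differentiable_expansion => //; apply/eqaddoP => e e0.
  have := C1_increment oU Uy0 gC e0.
  by apply: filterS => h; rewrite /= opprD addrA.
by split=> // h; rewrite dE.
Qed.

(** Reduces a directional derivative to one variable, where the chain rule is
    available for functions that are merely derivable along a line. *)
Lemma derive_line (E F : normedModType R) (f : E -> F) x v :
  'D_v f x = 'D_1 (fun t : R => f (t *: v + x)) 0.
Proof.
rewrite /derive; set g1 := (X in lim (X @ _) = _).
set g2 := (X in _ = lim (X @ _)); suff -> : g1 = g2 by [].
by apply/funext => h; rewrite /g1 /g2 /= addr0 scale0r add0r [_%:A]mulr1.
Qed.

(** Chain rule with an inner function that is derivable only along v: on the
    line through x it is a curve, along which g, being of class C1, is
    differentiable. *)
Lemma C1_comp_derive d (E : normedModType R) (W : set 'rV[R]_d)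
    (f : E -> 'rV[R]_d) (g : 'rV[R]_d -> R) x v :
  open W -> W (f x) -> Ck 1 W g -> derivable f x v ->
  derivable (fun x => g (f x)) x v /\
  'D_v (fun x => g (f x)) x = \sum_i 'D_v f x 0 i * 'D_('e_i) g (f x).
Proof.
move=> oW Wfx gC fv.
have [gd dgE] := C1_differentiable oW Wfx gC.
have ld : differentiable (fun t : R => f (t *: v + x)) 0.
  exact/derivable1_diffP/(derivable1P _ _ _).1.
have gd' : differentiable g (f (0 *: v + x)) by rewrite scale0r add0r.
have cd := differentiable_comp ld gd'.
split; first exact/derivable1P/derivable1_diffP.
have -> : 'D_v (fun x => g (f x)) x = 'D_1 (g \o (fun t : R => f (t *: v + x))) 0.
  exact: derive_line.
rewrite (deriveE (1 : R) cd) (diff_comp ld gd') /= -(deriveE (1 : R) ld) -derive_line.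
by rewrite scale0r add0r dgE.
Qed.

(** By the chain rule a derivative of the composite is a sum of products of
    derivatives of the two functions, one of them composed again, so the
    induction on k closes. *)
Lemma Ck_comp d (E : normedModType R) k (U : set E) (W : set 'rV[R]_d)
    (f : E -> 'rV[R]_d) (g : 'rV[R]_d -> R) :
  open U -> open W -> (forall x, U x -> W (f x)) ->
  Ck k U f -> Ck k W g -> Ck k U (fun x => g (f x)).
Proof.
move=> oU oW UW; elim: k f g UW => [|k IH] f g UW fC gC.
  split=> // x Ux; apply: (@continuous_comp _ _ _ f g).
    exact: Ck_continuous fC Ux.
  exact: Ck_continuous gC (UW _ Ux).
split.
  move=> x Ux; apply: (@continuous_comp _ _ _ f g).
    exact: Ck_continuous fC Ux.
  exact: Ck_continuous gC (UW _ Ux).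
have gC1 : Ck 1 W g by exact: Ck_le gC.
move=> v; split.
  by move=> x Ux; apply: (C1_comp_derive oW (UW _ Ux) gC1 _).1; exact: (fC.2 v).1.
apply: (@Ck_eq _ _ _ _ (fun x => \sum_i 'D_v f x 0 i * 'D_('e_i) g (f x))) => //.
  move=> x Ux; apply/esym; apply: (C1_comp_derive oW (UW _ Ux) gC1 _).2.
  exact: (fC.2 v).1.
apply: Ck_sum => // i; apply: CkM => //.
  by apply: Ck_coord => //; exact: (fC.2 v).2.
by apply: (IH _ ('D_'e_i g)) => //; [exact: CkW|exact: (gC.2 'e_i).2].
Qed.

(** The derivative of a slice along v is the derivative of f along (0, v); left
    translations are slices of the multiplication. *)
Lemma Ck_slice (E1 E2 F : normedModType R) k (U : set (E1 * E2)) (f : E1 * E2 -> F) q :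
  Ck k U f -> Ck k [set p | U (q, p)] (fun p => f (q, p)).
Proof.
have ctn (h : E1 * E2 -> F) p : {for (q, p), continuous h} ->
    {for p, continuous (fun p => h (q, p))}.
  move=> hc; apply: (@continuous_comp _ _ _ (fun p => (q, p)) h) => //.
  by apply: cvg_pair; [exact: cvg_cst|exact: cvg_id].
have lE (h : E1 * E2 -> F) p v :
    (fun t : R => h (t *: (0, v) + (q, p))) = (fun t : R => h (q, t *: v + p)).
  apply/funext => t; congr h; congr pair => /=.
  by rewrite scaler0 add0r.
elim: k f => [|k IH] f [fc Hf]; first by split=> // p Up; apply: ctn; exact: fc.
split; first by move=> p Up; apply: ctn; exact: fc.
move=> v; have [df Hv] := Hf (0, v); split.
  move=> p Up; apply/derivable1P; rewrite -lE.
  exact/(derivable1P _ _ _).1/df.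
rewrite (_ : 'D_v _ = fun p => 'D_(0, v) f (q, p)); first exact: (IH _ Hv).
by apply/funext => p; rewrite [LHS]derive_line [RHS]derive_line lE.
Qed.

Lemma derive_slice (E1 E2 F : normedModType R) (f : E1 * E2 -> F) q p v :
  'D_(0, v) f (q, p) = 'D_v (fun p => f (q, p)) p.
Proof.
rewrite [LHS]derive_line [RHS]derive_line.
have -> // : (fun t : R => f (t *: (0, v) + (q, p))) = (fun t : R => f (q, t *: v + p)).
apply/funext => t; congr f; congr pair => /=.
by rewrite scaler0 add0r.
Qed.
End CkTheory.

(** * Smooth maps and left-invariant fields on a Lie group *)

Lemma pairl_continuous (T U : topologicalType) (b : U) :
  continuous (fun a : T => (a, b)).
Proof. by move=> x; apply: cvg_pair; [exact: cvg_id|exact: cvg_cst]. Qed.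

Lemma left_translation_continuous (G : ptopGroupType) (g : G) :
  continuous (fun z : G * G => (z.1 * z.2)%g) -> continuous (fun x : G => (g * x)%g).
Proof.
move=> mc x.
apply: (@continuous_comp _ _ _ (fun x => (g, x)) (fun z : G * G => (z.1 * z.2)%g)).
  by apply: cvg_pair; [exact: cvg_cst|exact: cvg_id].
exact: mc.
Qed.

Section Geometry.
Variables (R : realType) (d : nat) (G : ptopGroupType).
Variables (A : set (chart R d G)) (hG : lie_group A).
Implicit Types (W : set G) (f : G -> R) (c : chart R d G).

Lemma chart_imT c W p : is_chart c -> chart_im c W p ->
  [/\ chart_im c setT p, chart_dom c (chart_inv c p) & W (chart_inv c p)].
Proof.
by move=> hc [x [cx Wx] <-]; rewrite (chart_mapK hc cx); split => //; exists x.
Qed.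

Lemma chart_imI c W p : is_chart c -> chart_im c setT p -> W (chart_inv c p) ->
  chart_im c W p.
Proof.
by move=> hc [x [cx _] <-]; rewrite (chart_mapK hc cx) => Wx; exists x.
Qed.

(** A chart is a homeomorphism onto its open image. *)
Lemma open_chart_im c W : is_chart c -> open W -> open (chart_im c W).
Proof.
move=> hc oW; rewrite openE => p cWp; have [imp _ Wp] := chart_imT hc cWp.
have ci : \forall q \near p, W (chart_inv c q).
  by apply: (chart_inv_cont hc imp); exact: open_nbhs_nbhs.
have im : \forall q \near p, chart_im c setT q.
  by apply: open_nbhs_nbhs; split => //; exact: chart_im_open hc.
by rewrite /interior; apply: filterS2 ci im => q Wq imq; exact: chart_imI.
Qed.

Lemma smooth_on_continuous W f x : open W -> W x -> smooth_on A W f ->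
  {for x, continuous f}.
Proof.
move=> oW Wx fW; have [c Ac cx] := lie_cover hG x.
have hc := lie_charts hG Ac.
have cW : chart_im c W (chart_map c x) by exists x.
have fc := Ck_continuous (fW c Ac 0%N) cW.
have comp : {for x, continuous (fun y => f (chart_inv c (chart_map c y)))}.
  apply: (@continuous_comp _ _ _ (chart_map c) (fun p => f (chart_inv c p))).
    exact: chart_map_cont hc _ cx.
  exact: fc.
have domn : \forall y \near x, chart_dom c y.
  by apply: open_nbhs_nbhs; split => //; exact: chart_dom_open hc.
rewrite /prop_for /continuous_at -[f x]/(f x) -{2}(chart_mapK hc cx).
apply: cvg_trans comp; apply: near_eq_cvg; apply: filterS domn => y cy.
by rewrite (chart_mapK hc cy).
Qed.

(** Smoothness is tested in all charts, but the composite can be read locally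
    in any chart c2 around the value of h: there it is the composition of the
    expressions of f and of h. *)
Lemma smooth_on_comp (h : G -> G) W f : smooth_map A h -> open W ->
  smooth_on A W f -> smooth_on A (h @^-1` W) (fun x => f (h x)).
Proof.
move=> [hc hs] oW fW c1 Ac1 k; apply: Ck_local => p /= p1.
have c1c := lie_charts hG Ac1.
have [imp dp Wp] := chart_imT c1c p1.
have [c2 Ac2 c2p] := lie_cover hG (h (chart_inv c1 p)).
have c2c := lie_charts hG Ac2.
pose U := chart_im c1 (h @^-1` (W `&` chart_dom c2)).
have oU : open U.
  apply: open_chart_im => //; move/continuousP : hc; apply.
  by apply: openI => //; exact: chart_dom_open c2c.
exists U; first exact: chart_imI.
have UP q : U q -> [/\ W (h (chart_inv c1 q)) & chart_dom c2 (h (chart_inv c1 q))].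
  by move=> /(chart_imT c1c)[_ _ []].
have E : Ck k U (fun q => (f \o chart_inv c2) (chart_map c2 (h (chart_inv c1 q)))).
  apply: (@Ck_comp _ _ _ _ _ (chart_im c2 W)) => //.
  - exact: open_chart_im.
  - by move=> q /UP[Wq c2q]; exists (h (chart_inv c1 q)).
  - apply: Ck_sub (hs c1 c2 Ac1 Ac2 k) => q /(chart_imT c1c)[qT _ [_ ?]].
    exact: chart_imI.
  - exact: fW.
apply: Ck_eq E => // q /UP[_ c2q] /=.
by rewrite (chart_mapK c2c).
Qed.

Lemma lmul_continuous (g : G) : continuous (fun x : G => (g * x)%g).
Proof. exact: (left_translation_continuous (lie_mul hG).1). Qed.

Lemma lmul_smooth (g : G) : smooth_map A (fun x : G => (g * x)%g).
Proof.
split; first exact: lmul_continuous.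
move=> c2 c3 Ac2 Ac3 k.
have [c1 Ac1 c1g] := lie_cover hG g.
have [_ ms] := lie_mul hG.
have c1c := lie_charts hG Ac1; have c2c := lie_charts hG Ac2.
have := Ck_slice (chart_map c1 g) (ms c1 c2 c3 Ac1 Ac2 Ac3 k).
rewrite /= (chart_mapK c1c c1g); apply: Ck_sub => p /(chart_imT c2c)[imp dp Wp] /=.
by split => //; exists g.
Qed.

Variable c0 : chart R d G.

Lemma lfield_lmul v f g x :
  lfield c0 v (fun y => f (g * y)%g) x = lfield c0 v f (g * x)%g.
Proof.
by rewrite /lfield; congr (derive _ _ _); apply/funext => p; rewrite mulgA.
Qed.

Hypotheses (Ac0 : A c0) (c01 : chart_dom c0 1%g).

(** The field of v is the derivative of f (q * p) in p at the neutral element.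
    As the multiplication is smooth jointly in both factors, this is a
    directional derivative of a C1 function of (q, p) along (0, v), hence a
    continuous function of q. *)
Lemma lfield_regular v W f x : open W -> W x -> smooth_on A W f ->
  {for x, continuous (lfield c0 v f)} /\
  derivable (fun p => f (x * chart_inv c0 p)%g) (chart_map c0 1%g) v.
Proof.
move=> oW Wx fW; have c0c := lie_charts hG Ac0.
have [c1 Ac1 c1x] := lie_cover hG x; have c1c := lie_charts hG Ac1.
have [mc ms] := lie_mul hG.
pose F (z : 'rV[R]_d * 'rV[R]_d) := f (chart_inv c1 z.1 * chart_inv c0 z.2)%g.
pose U := [set z : 'rV[R]_d * 'rV[R]_d |
  [/\ chart_im c1 setT z.1, chart_im c0 setT z.2 &
      (W `&` chart_dom c1) (chart_inv c1 z.1 * chart_inv c0 z.2)%g]].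
have oU : open U.
  rewrite openE => z [z1 z2 z12]; rewrite /interior /U /=.
  have n1 : \forall y \near z, chart_im c1 setT y.1.
    by apply: cvg_fst; apply: open_nbhs_nbhs; split=> //; exact: chart_im_open c1c.
  have n2 : \forall y \near z, chart_im c0 setT y.2.
    by apply: cvg_snd; apply: open_nbhs_nbhs; split=> //; exact: chart_im_open c0c.
  have n3 : \forall y \near z, (W `&` chart_dom c1) (chart_inv c1 y.1 * chart_inv c0 y.2)%g.
    have cc : {for z, continuous (fun y : 'rV[R]_d * 'rV[R]_d =>
        (chart_inv c1 y.1 * chart_inv c0 y.2)%g)}.
      apply: (@continuous_comp _ _ _ (fun y : 'rV[R]_d * 'rV[R]_d =>
        (chart_inv c1 y.1, chart_inv c0 y.2)) (fun z : G * G => (z.1 * z.2)%g)).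
        apply: cvg_pair.
          apply: (@continuous_comp _ _ _ fst (chart_inv c1)); first exact: cvg_fst.
          exact: chart_inv_cont c1c _ z1.
        apply: (@continuous_comp _ _ _ snd (chart_inv c0)); first exact: cvg_snd.
        exact: chart_inv_cont c0c _ z2.
      exact: mc.
    apply: cc; apply: open_nbhs_nbhs; split => //.
    by apply: openI => //; exact: chart_dom_open c1c.
  by apply: filterS3 n1 n2 n3 => y ? ? ?.
have FC : Ck 1 U F.
  pose H (z : 'rV[R]_d * 'rV[R]_d) :=
    chart_map c1 (chart_inv c1 z.1 * chart_inv c0 z.2)%g.
  have E : Ck 1 U (fun z => (f \o chart_inv c1) (H z)).
    apply: (@Ck_comp _ _ _ _ _ (chart_im c1 W)) => //.
    - exact: open_chart_im.
    - by move=> z [_ _ [? ?]]; exists (chart_inv c1 z.1 * chart_inv c0 z.2)%g.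
    - by apply: Ck_sub (ms c1 c0 c1 Ac1 Ac0 Ac1 1%N) => z [? ? []].
    - exact: fW.
  apply: Ck_eq E => // z [_ _ [_ dz]].
  by rewrite /H /= (chart_mapK c1c dz).
have imx y : chart_dom c1 y -> chart_im c1 setT (chart_map c1 y) by exists y.
have Uz : U (chart_map c1 x, chart_map c0 1%g).
  split=> /=; [exact: imx|by exists 1%g|].
  by rewrite (chart_mapK c1c c1x) (chart_mapK c0c c01) mulg1.
have [_ FD] := FC; have [dF [Fc _]] := FD (0, v).
have lE y : chart_dom c1 y ->
    lfield c0 v f y = 'D_(0, v) F (chart_map c1 y, chart_map c0 1%g).
  by move=> c1y; rewrite derive_slice /F /= (chart_mapK c1c c1y).
split.
  have cc : {for x, continuous (fun y => 'D_(0, v) F (chart_map c1 y, chart_map c0 1%g))}.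
    apply: (@continuous_comp _ _ _ (chart_map c1)
      (fun p => 'D_(0, v) F (p, chart_map c0 1%g))).
      exact: chart_map_cont c1c _ c1x.
    apply: (@continuous_comp _ _ _ (fun p : 'rV[R]_d => (p, chart_map c0 1%g))
      ('D_(0, v) F)); last exact: Fc.
    exact: pairl_continuous.
  have domn : \forall y \near x, chart_dom c1 y.
    by apply: open_nbhs_nbhs; split => //; exact: chart_dom_open c1c.
  rewrite /prop_for /continuous_at lE//; apply: cvg_trans cc.
  by apply: near_eq_cvg; apply: filterS domn => y cy; rewrite lE.
have := dF _ Uz => /derivable1P; rewrite /F /=.
under eq_fun do rewrite scaler0 add0r (chart_mapK c1c c1x).
by move=> xd; apply/derivable1P; exact: xd.
Qed.

End Geometry.

(** * Absolute continuity and affine changes of variable on the line *)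

Section AbsCont.
Variable R : realType.
Implicit Types (a b m p q : R) (g : R -> R).

Lemma abs_cont_eq a b g g' : (forall t, a <= t <= b -> g t = g' t) ->
  abs_cont a b g -> abs_cont a b g'.
Proof.
move=> gg' H e e0; have [r r0 K] := H e e0; exists r => // n x y xy dj sr.
rewrite (eq_bigr (fun i => `|g (y i) - g (x i)|)); first exact: K.
move=> i _; have [ax [xyi yb]] := xy i.
by rewrite !gg'// ?ax ?yb ?andbT//; [exact: le_trans xyi yb|exact: le_trans ax xyi].
Qed.

(** An interval across m is cut at m: [Num.min _ m] and [Num.max _ m] map its
    ends to those of its two pieces, one of which is degenerate when the interval
    does not contain m. *)
Lemma abs_cont_glue a m b g : a <= m -> m <= b ->
  abs_cont a m g -> abs_cont m b g -> abs_cont a b g.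
Proof.
move=> am mb H1 H2 e e0; have e20 : 0 < e / 2 by rewrite divr_gt0.
have [r1 r10 K1] := H1 _ e20; have [r2 r20 K2] := H2 _ e20.
exists (Num.min r1 r2); first by rewrite lt_min r10.
move=> n x y xy dj; rewrite lt_min => /andP[s1 s2].
have S1 : \sum_(i < n) `|g (Num.min (y i) m) - g (Num.min (x i) m)| < e / 2.
  apply: K1.
  - move=> i; have [ax [xyi yb]] := xy i; split; first by rewrite le_min ax.
    by split; [apply: le_min2|rewrite ge_min lexx orbT].
  - by move=> i j /dj[] ?; [left|right]; apply: le_min2.
  - apply: le_lt_trans s1; apply: ler_sum => i _; have [ax [xyi yb]] := xy i.
    rewrite /Num.min; case: ltP => ym; case: ltP => xm; lra.
have S2 : \sum_(i < n) `|g (Num.max (y i) m) - g (Num.max (x i) m)| < e / 2.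
  apply: K2.
  - move=> i; have [ax [xyi yb]] := xy i; split; first by rewrite le_max lexx orbT.
    by split; [apply: le_max2|rewrite ge_max yb].
  - by move=> i j /dj[] ?; [left|right]; apply: le_max2.
  - apply: le_lt_trans s2; apply: ler_sum => i _; have [ax [xyi yb]] := xy i.
    rewrite /Num.max; case: ltP => ym; case: ltP => xm; lra.
rewrite (splitr e); apply: le_lt_trans (ltrD S1 S2); rewrite -big_split/=.
apply: ler_sum => i _; have [ax [xyi yb]] := xy i.
apply: le_trans (ler_normD _ _); rewrite le_eqVlt; apply/orP; left; apply/eqP; congr (`| _ |).
rewrite /Num.min /Num.max; case: ltP => ym; case: ltP => xm; lra.
Qed.

(** The min and the max allow for p < 0, that is for reversed paths. *)
Lemma abs_cont_affine a b p q g : p != 0 ->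
  abs_cont (Num.min (p * a + q) (p * b + q)) (Num.max (p * a + q) (p * b + q)) g ->
  abs_cont a b (fun t => g (p * t + q)).
Proof.
move=> p0 H e e0; have [r r0 K] := H e e0.
have np0 : 0 < `|p| by rewrite normr_gt0.
exists (r / `|p|); first by rewrite divr_gt0.
move=> n x y xy dj sr.
have [p_gt0|p_le0] := ltP 0 p.
  apply: (K n (fun i => p * x i + q) (fun i => p * y i + q)).
  - move=> i; have [ax [xyi yb]] := xy i.
    rewrite ge_min le_max !lerD2r !(ler_pM2l p_gt0) ax yb xyi orbT; split => //.
  - by move=> i j /dj[] ?; [left|right]; rewrite lerD2r ler_pM2l.
  - rewrite (eq_bigr (fun i => `|p| * (y i - x i))).
      by rewrite -mulr_sumr -ltr_pdivlMl// mulrC.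
    by move=> i _; rewrite gtr0_norm//; ring.
have {p_le0}p_lt0 : p < 0 by rewrite lt_neqAle p0.
rewrite (eq_bigr (fun i => `|g (p * x i + q) - g (p * y i + q)|)); last first.
  by move=> i _; rewrite distrC.
apply: (K n (fun i => p * y i + q) (fun i => p * x i + q)).
- move=> i; have [ax [xyi yb]] := xy i.
  by rewrite ge_min le_max !lerD2r !(ler_nM2l p_lt0) ax yb xyi orbT.
- by move=> i j /dj[] ?; [right|left]; rewrite lerD2r ler_nM2l.
- rewrite (eq_bigr (fun i => `|p| * (y i - x i))).
    by rewrite -mulr_sumr -ltr_pdivlMl// mulrC.
  by move=> i _; rewrite ltr0_norm//; ring.
Qed.

End AbsCont.

Section LebesgueAffine.
Variable R : realType.
Local Notation lebR := (@lebesgue_measure R).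
Variables (p q : R) (p0 : p != 0).

Let phi (t : measurableTypeR R) : measurableTypeR R := p * t + q.

Lemma measurable_affine : measurable_fun setT phi.
Proof. by apply: measurable_funD => //; exact: measurable_funM. Qed.

Let affine_image : {measure set (measurableTypeR R) -> \bar R}.
Proof.
unshelve refine [the {measure set (measurableTypeR R) -> \bar R} of
  pushforward lebR phi].
exact: measurable_affine.
Defined.

(** Both sides are measures of the set D that agree on half-open intervals. *)
Lemma lebesgue_affine (D : set R) : measurable D ->
  (lebR D = `|p|%:E * lebR ((fun t : R => p * t + q)%R @^-1` D))%E.
Proof.
move=> mD; rewrite -[RHS]/(mscale (NngNum (normr_ge0 p)) affine_image D).
apply: lebesgue_measure_unique => //=.
  move=> _ [[a b]] _ <-; rewrite /mscale/= /pushforward lebesgue_measure_itv/= lte_fin.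
  have [p_gt0|p_le0] := ltP 0 p.
    rewrite (_ : _ @^-1` _ = `](a - q) / p, (b - q) / p]%classic); last first.
      apply/seteqP; split => t /=; rewrite !in_itv/= /phi ltr_pdivrMr// ler_pdivlMr//.
        by move=> /andP[? ?]; apply/andP; split; lra.
      by move=> /andP[? ?]; apply/andP; split; lra.
    rewrite lebesgue_measure_itv/= lte_fin ltr_pM2r ?invr_gt0// ltrD2r.
    case: ifPn => _; last by rewrite mule0.
    by rewrite gtr0_norm// -EFinM -mulrBl mulrC divfK//; congr EFin; ring.
  have {p_le0}p_lt0 : p < 0 by rewrite lt_neqAle p0.
  rewrite (_ : _ @^-1` _ = `[(b - q) / p, (a - q) / p[%classic); last first.
    apply/seteqP; split => t /=; rewrite !in_itv/= /phi ltr_ndivlMr// ler_ndivrMr//.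
      by move=> /andP[? ?]; apply/andP; split; lra.
    by move=> /andP[? ?]; apply/andP; split; lra.
  rewrite lebesgue_measure_itv/= lte_fin ltr_nM2r ?invr_lt0// ltrD2r.
  case: ifPn => _; last by rewrite mule0.
  by rewrite ltr0_norm// -EFinM -mulrBl mulNr mulrC divfK//; congr EFin; ring.
Qed.

Lemma integral_affine (D : set R) (f : R -> \bar R) : measurable D ->
  measurable_fun D f -> (forall x, D x -> 0 <= f x)%E ->
  (\int[lebR]_(x in D) f x =
   `|p|%:E * \int[lebR]_(t in (fun t : R => p * t + q)%R @^-1` D) f (p * t + q)%R)%E.
Proof.
move=> mD mf f0.
have -> : (\int[lebR]_(t in (fun t : R => p * t + q)%R @^-1` D) f (p * t + q)%R =
    \int[affine_image]_(x in D) f x)%E.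
  by rewrite [RHS](ge0_integral_pushforward measurable_affine)// => x /[!inE]; exact: f0.
rewrite -(@ge0_integral_mscale _ _ R affine_image D mD (NngNum (normr_ge0 p)))//.
by apply: eq_measure_integral => //= B mB BD; exact: lebesgue_affine.
Qed.

Lemma ae_affine (P : R -> Prop) : {ae lebR, forall t, P t} ->
  {ae lebR, forall t, P (p * t + q)}.
Proof.
move=> [N [mN N0 PN]]; exists ((fun t : R => p * t + q) @^-1` N); split.
- by rewrite -[X in measurable X]setTI; exact: measurable_affine.
- have := lebesgue_affine mN; rewrite N0 => /esym/eqP.
  by rewrite mule_eq0 eqe normr_eq0 (negbTE p0) => /eqP.
- by move=> t /= nP; apply: PN.
Qed.

End LebesgueAffine.

(** * Reparametrization and concatenation of horizontal paths *)

Lemma lebesgue_ae_imp (R : realType) (P Q : R -> Prop) :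
  {ae @lebesgue_measure R, forall x, P x} -> (forall x, P x -> Q x) ->
  {ae @lebesgue_measure R, forall x, Q x}.
Proof.
by move=> [N [mN N0 PN]] PQ; exists N; split=> // x nQ; apply: PN => /PQ.
Qed.

Lemma lebesgue_ae_and (R : realType) (P Q : R -> Prop) :
  {ae @lebesgue_measure R, forall x, P x} ->
  {ae @lebesgue_measure R, forall x, Q x} ->
  {ae @lebesgue_measure R, forall x, P x /\ Q x}.
Proof.
move=> [N [mN N0 PN]] [M [mM M0 QM]]; exists (N `|` M); split.
- exact: measurableU.
- by apply: null_set_setU.
- move=> x /not_andP[nP|nQ]; [left; exact: PN|right; exact: QM].
Qed.

Section Affine.
Variable R : realType.

Lemma affine_itv (p q u v t : R) : p != 0 -> u <= v ->
  (Num.min (p * u + q) (p * v + q) <= p * t + q <= Num.max (p * u + q) (p * v + q))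
  = (u <= t <= v).
Proof.
move=> p0 uv; have [p_gt0|p_le0] := ltP 0 p.
  have puv : p * u + q <= p * v + q by rewrite lerD2r ler_pM2l.
  by rewrite min_l// max_r// !lerD2r !ler_pM2l.
have {p_le0}p_lt0 : p < 0 by rewrite lt_neqAle p0.
have pvu : p * v + q <= p * u + q by rewrite lerD2r ler_nM2l.
by rewrite min_r// max_l// !lerD2r !ler_nM2l// andbC.
Qed.

Lemma derive_affine (g : R -> R) (p q t : R) :
  derivable g (p * t + q) 1 ->
  derivable (fun s => g (p * s + q)) t 1 /\
  'D_1 (fun s => g (p * s + q)) t = p * 'D_1 g (p * t + q).
Proof.
move=> gd; pose phi (s : R) := p * s + q.
have phid : is_derive t (1 : R) phi p.
  by rewrite /phi; apply: is_derive_eq; rewrite /GRing.scale/= mulr1 addr0.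
have phid' : derivable phi t 1 by case: phid.
have dg : is_derive (phi t) (1 : R) g ('D_1 g (phi t)) by split.
split; first by apply/derivable1_diffP; apply: (@differentiable_comp _ _ _ _ phi g);
  exact/derivable1_diffP.
rewrite -!derive1E -[LHS]/(derive1 (g \o phi) t) derive1_comp//.
by rewrite [X in _ * X]derive1E derive_val mulrC derive1E.
Qed.

End Affine.

Section Paths.
Variables (R : realType) (d : nat) (G : ptopGroupType).
Variables (A : set (chart R d G)) (hG : lie_group A).
Variables (c0 : chart R d G) (k : nat) (X : k.-tuple 'rV[R]_d).
Local Open Scope complex_scope.
Implicit Types (W : set G) (f : G -> R) (l : R -> G) (a : 'I_k -> R -> R[i]).
Local Notation lebR := (@lebesgue_measure R).

(** Admissibility at the time t, with the coefficients a of the velocity in the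
    horizontal frame, tested on locally defined smooth functions. *)
Definition velocity l a (t : R) : Prop :=
  forall W f, open W -> W (l t) -> smooth_on A W f ->
    derivable (fun s => f (l s)) t 1 /\
    ('D_1 (fun s => f (l s)) t)%:C =
      \sum_(i < k) a i t * (lfield c0 (tnth X i) f (l t))%:C.

(** Admissibility over an arbitrary interval of times instead of the unit one,
    so that paths can be cut, reparametrized and concatenated. *)
Definition seg_adm (u v : R) l a : Prop :=
  [/\ {within `[u, v], continuous l},
      forall (x y : R) W f, u <= x -> x <= y -> y <= v -> open W ->
        (forall t, t \in `[x, y] -> W (l t)) -> smooth_on A W f ->
        abs_cont x y (fun t => f (l t)),
      forall i, measurable_fun (`[u, v] : set R) (fun t => complex.Re (a i t)) /\
                measurable_fun (`[u, v] : set R) (fun t => complex.Im (a i t)) &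
      {ae lebR, forall t : R, t \in `[u, v] -> velocity l a t}].

Definition speed a (t : R) : R :=
  Num.sqrt (\sum_(i < k) Normc.normc (a i t) ^+ 2).

Lemma admissibleP l a : admissible A c0 X l a <-> seg_adm 0 1 l a.
Proof. by split=> [[[? ?] ? ?]|[? ? ? ?]]; split=> //; split. Qed.

Lemma speed_ge0 a t : 0 <= speed a t. Proof. exact: sqrtr_ge0. Qed.

Lemma measurable_speed (D : set R) a : measurable D ->
  (forall i, measurable_fun D (fun t => complex.Re (a i t)) /\
             measurable_fun D (fun t => complex.Im (a i t))) ->
  measurable_fun D (fun t => (speed a t)%:E).
Proof.
move=> mD ma; apply/measurable_EFinP; rewrite /speed.
apply: (@measurableT_comp _ _ _ _ _ _ (@Num.sqrt R)).
  by apply: continuous_measurable_fun; exact: sqrt_continuous.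
apply: measurable_sum => i; have [m1 m2] := ma i.
apply: (@eq_measurable_fun _ _ _ _ _ (fun t => complex.Re (a i t) ^+ 2 + complex.Im (a i t) ^+ 2)).
  by move=> t _; case: (a i t) => x y /=; rewrite sqr_sqrtr// addr_ge0// sqr_ge0.
by apply: measurable_funD; exact: measurable_funX.
Qed.

Lemma normcZ (c : R) (z : R[i]) : Normc.normc (c%:C * z) = `|c| * Normc.normc z.
Proof.
case: z => x y /=; rewrite !mul0r subr0 addr0 !exprMn -mulrDr sqrtrM ?sqr_ge0//.
by rewrite sqrtr_sqr.
Qed.

Lemma speedZ (c : R) a (g : R -> R) t :
  speed (fun i t => c%:C * a i (g t)) t = `|c| * speed a (g t).
Proof.
rewrite /speed; under eq_bigr do rewrite normcZ exprMn.
by rewrite -mulr_sumr sqrtrM ?sqr_ge0// sqrtr_sqr normr_id.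
Qed.

Lemma velocity_affine (p q : R) l a t : velocity l a (p * t + q) ->
  velocity (fun s => l (p * s + q)) (fun i s => p%:C * a i (p * s + q)) t.
Proof.
move=> H W f oW Wl fW; have [df E] := H W f oW Wl fW.
have [df' E'] := derive_affine df; split => //.
by rewrite E' rmorphM/= E mulr_sumr; apply: eq_bigr => i _; rewrite mulrA.
Qed.

(** The coefficients are multiplied by p, whose sign is arbitrary: p = - 1 is
    the reversal of a path. *)
Lemma seg_affine (u v p q : R) l a : p != 0 -> u <= v ->
  seg_adm (Num.min (p * u + q) (p * v + q)) (Num.max (p * u + q) (p * v + q)) l a ->
  seg_adm u v (fun t => l (p * t + q)) (fun i t => p%:C * a i (p * t + q)).
Proof.
move=> p0 uv [lc lac ma lae]; set U := Num.min _ _ in lc lac ma lae.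
set V := Num.max _ _ in lc lac ma lae.
have UV t : (U <= p * t + q <= V) = (u <= t <= v) by exact: affine_itv.
split.
- apply/subspace_continuousP => t /= tuv.
  move/subspace_continuousP : lc => /(_ (p * t + q)) /=.
  rewrite in_itv/= UV; move: (tuv); rewrite in_itv/= => {}tuv /(_ tuv) lc.
  apply: cvg_comp lc => B /=; rewrite /within /nbhs/= => BN.
  have pc : {for t, continuous (fun t : R => p * t + q)}.
    by apply: cvgD; [apply: cvgM; [exact: cvg_cst|exact: cvg_id]|exact: cvg_cst].
  have := pc _ BN; apply: (@filterS _ (nbhs t) (nbhs_filter t)) => s /= sB; rewrite in_itv/= -UV => suv.
  by apply: sB; rewrite in_itv/=.
- move=> x y W f ux xy yv oW Wl fW; apply: (@abs_cont_affine _ x y p q (fun t => f (l t))) => //.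
  apply: lac fW => //.
  + by have := UV x; have := UV y; rewrite ux yv (le_trans ux xy) (le_trans xy yv) => /andP[? ?] /andP[? ?]; rewrite le_min; apply/andP.
  + by rewrite ge_min !le_max !lexx orbT.
  + by have := UV x; have := UV y; rewrite ux yv (le_trans ux xy) (le_trans xy yv) => /andP[? ?] /andP[? ?]; rewrite ge_max; apply/andP.
  + move=> t; rewrite in_itv/= => txy.
    have tE : t = p * ((t - q) / p) + q by rewrite mulrC divfK// subrK.
    by rewrite tE; apply: Wl; rewrite in_itv/= -(affine_itv q _ p0 xy) -tE.
- move=> i; have [m1 m2] := ma i.
  have pre : (fun t : R => p * t + q) @` `[u, v]%classic `<=` `[U, V]%classic.
    by move=> _ [t /= tuv <-]; move: tuv; rewrite !in_itv/= UV.
  have maff : measurable_fun `[u, v]%classic (fun t : R => p * t + q).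
    by apply: measurable_funTS; exact: measurable_affine.
  split.
    apply: (@eq_measurable_fun _ _ _ _ _ (fun t => p * complex.Re (a i (p * t + q)))).
      by move=> t _; case: (a i _) => x y /=; rewrite mul0r subr0.
    apply: measurable_funM => //.
    exact: (@measurable_comp _ _ _ _ _ _ `[U, V]%classic (fun s => complex.Re (a i s))).
  apply: (@eq_measurable_fun _ _ _ _ _ (fun t => p * complex.Im (a i (p * t + q)))).
    by move=> t _; case: (a i _) => x y /=; rewrite mul0r addr0.
  apply: measurable_funM => //.
  exact: (@measurable_comp _ _ _ _ _ _ `[U, V]%classic (fun s => complex.Im (a i s))).
- refine (lebesgue_ae_imp (ae_affine q p0 lae) _) => t H tuv; apply: velocity_affine.
  by apply: H; move: tuv; rewrite !in_itv/= UV.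
Qed.

Lemma length_affine (u v p q : R) l a : p != 0 -> u <= v ->
  seg_adm (Num.min (p * u + q) (p * v + q)) (Num.max (p * u + q) (p * v + q)) l a ->
  (\int[lebR]_(t in `[u, v]) (speed (fun i t => p%:C * a i (p * t + q)%R)%R t)%:E =
   \int[lebR]_(t in `[(Num.min (p * u + q) (p * v + q))%R,
     (Num.max (p * u + q) (p * v + q))%R]) (speed a t)%:E)%E.
Proof.
move=> p0 uv [lc lac ma lae].
under eq_integral do rewrite (speedZ _ _ (fun t => p * t + q)).
rewrite (integral_affine q p0)//; last 2 first.
- exact: measurable_speed.
- by move=> x _; rewrite lee_fin speed_ge0.
have -> : ((fun t : R => p * t + q) @^-1`
  `[Num.min (p * u + q) (p * v + q), Num.max (p * u + q) (p * v + q)]) = `[u, v]%classic.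
  by apply/seteqP; split => t /=; rewrite !in_itv/= affine_itv.
rewrite -ge0_integralZl//=.
- apply: (@measurable_comp _ _ _ _ _ _ `[Num.min (p * u + q) (p * v + q),
      Num.max (p * u + q) (p * v + q)]%classic (fun s => (speed a s)%:E)) => //.
  + by move=> _ [t /= tuv <-]; move: tuv; rewrite !in_itv/= affine_itv.
  + exact: measurable_speed.
  + by apply: measurable_funTS; exact: measurable_affine.
- by move=> t _; rewrite lee_fin speed_ge0.
Qed.

(** The middle time m is negligible, and away from it the concatenation agrees
    near each time with one of the two paths.  Absolute continuity on an interval
    across m comes from its two halves. *)
Lemma seg_glue (u m v : R) l1 l2 a1 a2 : u <= m -> m <= v -> l1 m = l2 m ->
  seg_adm u m l1 a1 -> seg_adm m v l2 a2 ->
  seg_adm u v (fun t => if t <= m then l1 t else l2 t)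
              (fun i t => if t <= m then a1 i t else a2 i t).
Proof.
move=> um mv l12 [lc1 lac1 ma1 lae1] [lc2 lac2 ma2 lae2].
set l := fun t => _; set a := fun i t => _.
have l1E t : t <= m -> l t = l1 t by rewrite /l => ->.
have l2E t : m <= t -> l t = l2 t.
  by rewrite le_eqVlt => /predU1P[<-|mt]; rewrite /l ?lexx// leNgt mt.
have uvE : `[u, v]%classic = `[u, m]%classic `|` `[m, v]%classic.
  apply/seteqP; split=> t /=; rewrite !in_itv/=.
    by move=> /andP[-> ->]; rewrite andbT; exact/orP/le_total.
  by move=> [/andP[-> /le_trans ->]|/andP[/(le_trans um) -> ->]].
split.
- rewrite uvE; apply: withinU_continuous.
  + exact: interval_closed.
  + exact: interval_closed.
  + apply: subspace_eq_continuous lc1 => t; rewrite inE/= in_itv/= => /andP[_ tm].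
    by rewrite /from_subspace l1E.
  + apply: subspace_eq_continuous lc2 => t; rewrite inE/= in_itv/= => /andP[mt _].
    by rewrite /from_subspace l2E.
- move=> x y W f ux xy yv oW Wl fW.
  have H1 y' : x <= y' -> y' <= y -> y' <= m -> abs_cont x y' (fun t => f (l t)).
    move=> xy' y'y y'm; apply: (@abs_cont_eq _ _ _ (fun t => f (l1 t))).
      by move=> t /andP[xt ty]; rewrite l1E// (le_trans ty).
    apply: lac1 fW => // t; rewrite in_itv/= => /andP[xt ty].
    by rewrite -l1E ?(le_trans ty)//; apply: Wl; rewrite in_itv/= xt (le_trans ty).
  have H2 x' : x <= x' -> x' <= y -> m <= x' -> abs_cont x' y (fun t => f (l t)).
    move=> xx' x'y mx'; apply: (@abs_cont_eq _ _ _ (fun t => f (l2 t))).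
      by move=> t /andP[xt ty]; rewrite l2E// (le_trans mx').
    apply: lac2 fW => // t; rewrite in_itv/= => /andP[xt ty].
    by rewrite -l2E ?(le_trans mx')//; apply: Wl; rewrite in_itv/= ty (le_trans xx').
  have [ym|/ltW my] := leP y m; first exact: H1.
  have [xm|/ltW mx] := leP x m; last exact: H2.
  by apply: (@abs_cont_glue _ _ m); [| |exact: H1|exact: H2].
- move=> i; have [m1 m2] := ma1 i; have [m3 m4] := ma2 i.
  have E : `[u, v]%classic = `[u, m]%classic `|` `]m, v]%classic.
    apply/seteqP; split=> t /=; rewrite !in_itv/=.
      by move=> /andP[-> ->]; case: (leP t m) => _; [left|right].
    by move=> [/andP[-> /le_trans ->]|/andP[/ltW/(le_trans um) -> ->]].
  have S : (`]m, v] `<=` `[m, v])%classic.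
    by move=> t /=; rewrite !in_itv/= => /andP[/ltW -> ->].
  rewrite E; split; apply/measurable_funU => //; split.
  + by apply: eq_measurable_fun m1 => t; rewrite inE/= in_itv/= /a => /andP[_ ->].
  + apply: eq_measurable_fun (measurable_funS _ S m3) => // t.
    by rewrite inE/= in_itv/= /a => /andP[]; rewrite ltNge => /negbTE ->.
  + by apply: eq_measurable_fun m2 => t; rewrite inE/= in_itv/= /a => /andP[_ ->].
  + apply: eq_measurable_fun (measurable_funS _ S m4) => // t.
    by rewrite inE/= in_itv/= /a => /andP[]; rewrite ltNge => /negbTE ->.
- have aem : {ae lebR, forall t : R, t != m}.
    exists [set m]; split; [exact: measurable_set1|exact: lebesgue_measure_set1|].
    by move=> t /= /negP; rewrite negbK => /eqP.
  refine (lebesgue_ae_imp (lebesgue_ae_and (lebesgue_ae_and lae1 lae2) aem) _) => t [[V1 V2] tm].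
  rewrite in_itv/= => /andP[ut tv].
  have trans l' a' : velocity l' a' t -> (\forall s \near t, l s = l' s) ->
      (forall i, a i t = a' i t) -> velocity l a t.
    move=> V nl aE W f oW; rewrite (nbhs_singleton nl) => Wl fW.
    have [fd fE] := V W f oW Wl fW.
    have nf : \forall s \near t, f (l' s) = f (l s).
      by apply: filterS nl => s ->.
    split; first exact: near_eq_derivable fd.
    rewrite -(near_eq_derive _ nf) fE; apply: eq_bigr => i _.
    by rewrite aE.
  have [tm'|tm'] := ltP t m.
    apply: trans; first by apply: V1; rewrite in_itv/= ut ltW.
      by near=> s; apply: l1E; apply: ltW; near: s; exact: lt_nbhsl.
    by move=> i; rewrite /a ltW.
  have {}tm' : m < t by rewrite lt_neqAle eq_sym tm.
  apply: trans; first by apply: V2; rewrite in_itv/= tv ltW.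
    by near=> s; apply: l2E; apply: ltW; near: s; exact: lt_nbhsr.
  by move=> i; rewrite /a leNgt tm'.
Unshelve. all: by end_near. Qed.

Lemma length_glue (u m v : R) l1 l2 a1 a2 : u <= m -> m <= v ->
  seg_adm u m l1 a1 -> seg_adm m v l2 a2 ->
  (\int[lebR]_(t in `[u, v])
     (speed (fun i t => if (t <= m)%R then a1 i t else a2 i t) t)%:E =
   \int[lebR]_(t in `[u, m]) (speed a1 t)%:E +
   \int[lebR]_(t in `[m, v]) (speed a2 t)%:E)%E.
Proof.
move=> um mv [lc1 lac1 ma1 lae1] [lc2 lac2 ma2 lae2].
pose a i t := if t <= m then a1 i t else a2 i t.
rewrite -/a.
have E : `[u, v]%classic = `[u, m]%classic `|` `]m, v]%classic.
  apply/seteqP; split=> t /=; rewrite !in_itv/=.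
    by move=> /andP[-> ->]; case: (leP t m) => _; [left|right].
  by move=> [/andP[-> /le_trans ->]|/andP[/ltW/(le_trans um) -> ->]].
have S : (`]m, v] `<=` `[m, v])%classic.
  by move=> t /=; rewrite !in_itv/= => /andP[/ltW -> ->].
have E1 : {in `[u, m]%classic, (fun t => (speed a1 t)%:E) =1 (fun t => (speed a t)%:E)}.
  by move=> t; rewrite inE/= in_itv/= /a /speed => /andP[_ ->].
have E2 : {in `]m, v]%classic, (fun t => (speed a2 t)%:E) =1 (fun t => (speed a t)%:E)}.
  move=> t; rewrite inE/= in_itv/= /a /speed => /andP[].
  by rewrite ltNge => /negbTE ->.
have M1 := measurable_speed (measurable_itv _) ma1.
have M2 := measurable_funS (measurable_itv _) S (measurable_speed (measurable_itv _) ma2).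
rewrite E ge0_integral_setU//=.
- congr (_ + _)%E.
    by apply: eq_integral => t tum; rewrite -E1.
  rewrite -integral_itv_obnd_cbnd//.
  by apply: eq_integral => t tum; rewrite -E2.
- apply/measurable_funU => //; split; first exact: eq_measurable_fun M1.
  exact: eq_measurable_fun M2.
- by move=> x _; rewrite lee_fin speed_ge0.
- apply/disj_setPS => t /= []; rewrite !in_itv/= => /andP[_ tm] /andP[mt _].
  by rewrite ltNge tm in mt.
Qed.

End Paths.

(** * Balls of the Carnot-Caratheodory distance *)

Section CC.
Variables (R : realType) (d : nat) (G : ptopGroupType).
Variables (A : set (chart R d G)) (hG : lie_group A).
Variables (c0 : chart R d G) (k : nat) (X : k.-tuple 'rV[R]_d).
Local Open Scope complex_scope.
Implicit Types (W : set G) (f : G -> R) (l : R -> G) (a : 'I_k -> R -> R[i]).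
Local Notation lebR := (@lebesgue_measure R).
Local Notation seg_adm := (seg_adm A c0 X).
Local Notation cc_dist := (cc_dist A c0 X).

Definition seg_length (u v : R) a : \bar R :=
  (\int[lebR]_(t in `[u, v]) (speed a t)%:E)%E.

Lemma seg_length_ge0 u v a : (0 <= seg_length u v a)%E.
Proof. by apply: integral_ge0 => t _; rewrite lee_fin speed_ge0. Qed.

Lemma cc_dist_lt x y (r : \bar R) : (cc_dist x y < r)%E ->
  exists l a, [/\ seg_adm 0 1 l a, l 0 = x, l 1 = y & (seg_length 0 1 a < r)%E].
Proof.
move=> /ereal_inf_lt[_ [l [a [/admissibleP la l0 l1 ->]]] lr].
by exists l, a.
Qed.

Lemma cc_dist_le x y l a : seg_adm 0 1 l a -> l 0 = x -> l 1 = y ->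
  (cc_dist x y <= seg_length 0 1 a)%E.
Proof.
move=> la l0 l1; apply: ereal_inf_lbound; exists l, a; split => //.
exact/admissibleP.
Qed.

Lemma cc_dist_ge0 x y : (0 <= cc_dist x y)%E.
Proof.
apply: le_ereal_inf_tmp => _ [l [a [_ _ _ ->]]].
exact: (seg_length_ge0 0 1 a).
Qed.

(** Testing h o l on f is testing l on f o h, whose horizontal derivatives are
    c times those of f. *)
Lemma seg_push (h : G -> G) (c : R) (u v : R) l a : smooth_map A h ->
  (forall i W f x, open W -> smooth_on A W f -> W (h x) ->
     lfield c0 (tnth X i) (fun y => f (h y)) x = c * lfield c0 (tnth X i) f (h x)) ->
  seg_adm u v l a ->
  seg_adm u v (fun t => h (l t)) (fun i t => c%:C * a i t).
Proof.
move=> hs hX [lc lac ma lae].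
have oh W : open W -> open (h @^-1` W).
  by move: W; apply/continuousP; exact: hs.1.
split.
- apply/subspace_continuousP => t tuv; move/subspace_continuousP : lc.
  by move=> /(_ t tuv) lc; apply: cvg_comp lc _; exact: hs.1.
- move=> x y W f ux xy yv oW Wl fW.
  exact: (lac x y (h @^-1` W) (fun y => f (h y)) ux xy yv (oh _ oW) Wl
    (smooth_on_comp hG hs oW fW)).
- move=> i; have [m1 m2] := ma i; split.
    apply: (@eq_measurable_fun _ _ _ _ _ (fun t => c * complex.Re (a i t))).
      by move=> t _; case: (a i t) => x y /=; rewrite mul0r subr0.
    exact: measurable_funM.
  apply: (@eq_measurable_fun _ _ _ _ _ (fun t => c * complex.Im (a i t))).
    by move=> t _; case: (a i t) => x y /=; rewrite mul0r addr0.
  exact: measurable_funM.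
- refine (lebesgue_ae_imp lae _) => t Vt tuv W f oW Wl fW.
  have [fd fE] := Vt tuv (h @^-1` W) (fun y => f (h y)) (oh _ oW) Wl
    (smooth_on_comp hG hs oW fW).
  split => //; rewrite fE; apply: eq_bigr => i _.
  by rewrite (hX i W)// rmorphM/= mulrCA mulrA.
Qed.

(** The transported path has c times the length.  Applied below to left
    translations, with c = 1, and to dilations. *)
Lemma cc_ball_push (h : G -> G) (c r : R) x y : 0 < c -> smooth_map A h ->
  (forall i W f x, open W -> smooth_on A W f -> W (h x) ->
     lfield c0 (tnth X i) (fun y => f (h y)) x = c * lfield c0 (tnth X i) f (h x)) ->
  (cc_dist x y < r%:E)%E -> (cc_dist (h x) (h y) < (c * r)%:E)%E.
Proof.
move=> c_gt0 hs hX /cc_dist_lt[l [a [la l0 l1 lr]]].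
have := cc_dist_le (seg_push hs hX la) (congr1 h l0) (congr1 h l1).
move=> /le_lt_trans; apply; rewrite /seg_length.
under eq_integral do rewrite (speedZ _ _ id) EFinM.
rewrite ge0_integralZl//.
- by rewrite (EFinM c r) gtr0_norm// lte_pmul2l// lte_fin.
- by apply: measurable_speed => //; case: la.
- by move=> t _; rewrite lee_fin speed_ge0.
Qed.

(** Reversed paths have the same length. *)
Lemma cc_ball_sym (r : \bar R) x y :
  (cc_dist x y < r)%E -> (cc_dist y x < r)%E.
Proof.
move=> /cc_dist_lt[l [a [la l0 l1 lr]]].
have N10 : (-1 : R) != 0 by rewrite oppr_eq0 oner_eq0.
have E0 : -1 * 0 + 1 = 1 :> R by rewrite mulr0 add0r.
have E1 : -1 * 1 + 1 = 0 :> R by rewrite mulr1 addNr.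
have la' : seg_adm (Num.min (-1 * 0 + 1) (-1 * 1 + 1)) (Num.max (-1 * 0 + 1) (-1 * 1 + 1)) l a.
  by rewrite E0 E1 min_r// max_l.
have := cc_dist_le (seg_affine N10 ler01 la').
rewrite E0 E1 => /(_ _ _ l1 l0) /le_lt_trans; apply.
by rewrite /seg_length (length_affine N10 ler01 la') E0 E1 min_r// max_l.
Qed.

(** The two paths are run through at double speed, one after the other, with the
    change at the time 1 / 2. *)
Lemma cc_ball_trans (r s : R) x y z : (cc_dist x y < r%:E)%E ->
  (cc_dist y z < s%:E)%E -> (cc_dist x z < (r + s)%:E)%E.
Proof.
move=> /cc_dist_lt[l1 [a1 [la1 l10 l11 lr1]]] /cc_dist_lt[l2 [a2 [la2 l20 l21 lr2]]].
have n20 : (2 : R) != 0 by rewrite pnatr_eq0.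
have h0 : 0 <= 2^-1 :> R by rewrite invr_ge0.
have h1 : 2^-1 <= 1 :> R by rewrite invf_le1// ler1n.
have E10 : 2 * 0 + 0 = 0 :> R by rewrite mulr0 add0r.
have E11 : 2 * 2^-1 + 0 = 1 :> R by rewrite addr0 divff.
have E20 : 2 * 2^-1 - 1 = 0 :> R by rewrite divff// subrr.
have E21 : 2 * 1 - 1 = 1 :> R by rewrite mulr1; lra.
have la1' : seg_adm (Num.min (2 * 0 + 0) (2 * 2^-1 + 0)) (Num.max (2 * 0 + 0) (2 * 2^-1 + 0)) l1 a1.
  by rewrite E10 E11 min_l// max_r.
have la2' : seg_adm (Num.min (2 * 2^-1 - 1) (2 * 1 - 1)) (Num.max (2 * 2^-1 - 1) (2 * 1 - 1)) l2 a2.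
  by rewrite E20 E21 min_l// max_r.
have S1 := seg_affine n20 h0 la1'; have S2 := seg_affine n20 h1 la2'.
have G12 : l1 (2 * 2^-1 + 0) = l2 (2 * 2^-1 - 1) by rewrite E11 E20 l11 l20.
have S := seg_glue h0 h1 G12 S1 S2.
have := cc_dist_le S; rewrite h0 E10 leNgt invf_lt1// ltr1n/= E21.
move=> /(_ _ _ l10 l21)/le_lt_trans; apply.
rewrite /seg_length (length_glue h0 h1 S1 S2).
rewrite (length_affine n20 h0 la1') (length_affine n20 h1 la2') E10 E11 E20 E21.
by rewrite min_l// max_r// EFinD lteD.
Qed.

Lemma cc_ball_lmul (r : R) g x y :
  (cc_dist x y < r%:E)%E -> (cc_dist (g * x)%g (g * y)%g < r%:E)%E.
Proof.
move=> xyr; rewrite -[r]mul1r.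
apply: (@cc_ball_push (fun x => (g * x)%g)) => //; first exact: lmul_smooth.
by move=> i W f z _ _ _; rewrite mul1r lfield_lmul.
Qed.

(** The horizontal fields belong to the first layer, on which the dilation of
    ratio c acts by c. *)
Lemma cc_ball_dilation m (V : nat -> {vspace 'rV[R]_d}) delta (c r : R) x y :
  (0 < m)%N -> basis_of (V 1%N) X -> dilations A c0 m V delta -> 0 < c ->
  (cc_dist x y < r%:E)%E -> (cc_dist (delta c x) (delta c y) < (c * r)%:E)%E.
Proof.
move=> m0 hX hdelta c_gt0; apply: cc_ball_push => //.
  exact: dil_smooth hdelta _ c_gt0.
move=> i W f z oW fW Wz; rewrite -[c in RHS]expr1.
apply: (dil_diff hdelta c_gt0 (j := 1%N) _ _ oW fW Wz) => //.
by apply: basis_mem hX _; exact: mem_tnth.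
Qed.

End CC.

(** * Topological groups with a Haar measure *)

Section HaarGroup.
Variables (R : realType) (G : ptopGroupType).
Hypotheses (hsd : hausdorff_space G)
  (mulc : continuous (fun z : G * G => (z.1 * z.2)%g))
  (invc : continuous (fun x : G => (x^-1)%g)).
Variable mu : {sigma_finite_measure set (borelType G) -> \bar R}.
Hypothesis hmu : haar_measure mu.

Lemma mulg_near (x y : G) (W : set G) : nbhs (x * y)%g W ->
  exists U V : set G, [/\ nbhs x U, nbhs y V & forall a b, U a -> V b -> W (a * b)%g].
Proof.
move=> nW; have := @mulc (x, y) W nW => -[[U V] /= [Ux Vy] UV].
by exists U, V; split=> // a b Ua Vb; exact: (UV (a, b)).
Qed.

Let lmulc (g : G) : continuous (fun x : G => (g * x)%g).
Proof. exact: left_translation_continuous. Qed.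

Lemma open_borel (U : set G) : open U -> measurable (U : set (borelType G)).
Proof. by move=> oU; exact: sub_sigma_algebra. Qed.

Lemma closed_borel (U : set G) : closed U -> measurable (U : set (borelType G)).
Proof. by move=> cU; rewrite -[U]setCK; apply: measurableC; apply: open_borel; exact: closed_openC. Qed.

Lemma compact_borel (K : set G) : compact K -> measurable (K : set (borelType G)).
Proof. by move=> cK; apply: closed_borel; exact: compact_closed. Qed.

Lemma continuous_borel (h : G -> G) : continuous h ->
  measurable_fun setT (h : borelType G -> borelType G).
Proof.
move=> hc; apply: (@measurability _ _ (borelType G) (borelType G) setT h (@open G)) => // _ [U oU <-].
by rewrite setTI; apply: open_borel; move/continuousP : hc; apply.
Qed.

Lemma translate_borel (g : G) (B : set (borelType G)) : measurable B ->
  measurable ([set x : G | B (g * x)%g] : set (borelType G)).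
Proof.
move=> mB; have := continuous_borel (@lmulc g) => /(_ measurableT _ mB).
by rewrite setTI.
Qed.

(** Tube lemma: each point of K has a neighbourhood that small translations keep
    in U, and finitely many of these cover K. *)
Lemma compact_tube (K U : set G) : compact K -> open U -> K `<=` U ->
  \forall v \near (1%g : G), forall x, K x -> U (v * x)%g.
Proof.
move=> /compact_near_coveringP cK oU KU.
apply: (cK G (nbhs (1%g : G)) (fun v x => U (v * x)%g)) => x Kx.
have [V [W [V1 Wx VW]]] : exists V W : set G,
    [/\ nbhs (1%g : G) V, nbhs x W & forall a b, V a -> W b -> U (a * b)%g].
  by apply: mulg_near; rewrite mul1g; apply: open_nbhs_nbhs; split=> //; exact: KU.
by exists (W, V) => //= -[a b] /= [Wa Vb]; exact: VW.
Qed.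

(** Take a compact K inside an open U containing B, with U and K of measure close
    to that of B.  For v near the neutral element v K stays in U.  The part E of
    B inside K fills more than half of U, and so does v E, which is also
    contained in U; hence E and v E meet, and v is a quotient of two points of
    B. *)
Lemma steinhaus (B : set (borelType G)) : measurable B ->
  (0 < mu B)%E -> (mu B < +oo)%E ->
  \forall v \near (1%g : G), exists x y : G, [/\ B x, B y & v = (x * y^-1)%g].
Proof.
move=> mB B0 Boo.
have [b bE] : exists b : R, mu B = b%:E.
  by exists (fine (mu B)); rewrite fineK// ge0_fin_numE.
have b0 : 0 < b by rewrite -lte_fin -bE.
have [_ [U [oU BU] <-] mUb] : exists2 u, [set mu U | U in [set U : set G | open U /\ B `<=` U]] u &
    (u < (b + b / 4)%:E)%E.
  by apply: ereal_inf_lt; rewrite -(haar_outer hmu)// bE lte_fin ltrDl divr_gt0.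
have mU := open_borel oU.
have [u uE] : exists u : R, mu U = u%:E.
  by exists (fine (mu U)); rewrite fineK// ge0_fin_numE// (lt_trans mUb)// ltry.
have bu : b <= u by rewrite -lee_fin -bE -uE le_measure// inE.
have [_ [K [cK KU] <-] mKb] : exists2 v, [set mu K | K in [set K : set G | compact K /\ K `<=` U]] v &
    ((u - b / 4)%:E < v)%E.
  by apply: ereal_sup_gt; rewrite -(haar_inner hmu)// uE lte_fin ltrBlDr ltrDl divr_gt0.
have mK := compact_borel cK.
pose E : set (borelType G) := B `&` K.
have mE : measurable E by exact: measurableI.
have [e eE] : exists e : R, mu E = e%:E.
  exists (fine (mu E)); rewrite fineK// ge0_fin_numE//.
  by apply: le_lt_trans Boo; apply: le_measure; rewrite ?inE//; exact: subIsetl.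
(* With U of measure below 5 b / 4 and B \ K of measure below b / 4, both E and
   its translate exceed 3 b / 4, too much to be disjoint inside U. *)
have e3 : 3 * b / 4 < e.
  have H1 : mu B = (mu (B `\` K) + mu E)%E by exact: measureDI.
  have H2 : mu U = (mu (U `\` K) + mu (U `&` K))%E by exact: measureDI.
  have H3 : (mu (B `\` K) <= mu (U `\` K))%E.
    by apply: le_measure; rewrite ?inE//; [exact: measurableD|exact: measurableD|move=> x [/BU]].
  have UKE : U `&` K = K by apply/seteqP; split=> [x []//|x Kx]; split=> //; exact: KU.
  rewrite UKE in H2.
  have [x xE] : exists x : R, mu (U `\` K) = x%:E.
    exists (fine (mu (U `\` K))); rewrite fineK// ge0_fin_numE//.
    apply: (@le_lt_trans _ _ (mu U)); last by rewrite uE ltry.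
    by apply: le_measure; rewrite ?inE//; exact: measurableD.
  have [y yE] : exists y : R, mu K = y%:E.
    exists (fine (mu K)); rewrite fineK// ge0_fin_numE//; exact: haar_compact hmu _ cK.
  have [z zE] : exists z : R, mu (B `\` K) = z%:E.
    exists (fine (mu (B `\` K))); rewrite fineK// ge0_fin_numE//.
    by apply: le_lt_trans H3 _; rewrite xE ltry.
  move: H1 H2 H3 mUb mKb; rewrite bE uE eE xE yE zE -!EFinD !lte_fin !lee_fin.
  by move=> [H1] [H2] H3 H4 H5; lra.
have := compact_tube cK oU KU; apply: filterS => v vU.
pose vE : set (borelType G) := [set x : G | E (v^-1 * x)%g].
have mvE : measurable vE by exact: translate_borel.
have muvE : mu vE = e%:E by rewrite -eE; exact: (haar_left hmu).
have [[x [vEx Ex]]|/forallNP disj] := pselect (exists x, vE x /\ E x).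
  exists x, (v^-1 * x)%g; split; [exact: Ex.1|exact: vEx.1|].
  by rewrite invgM invgK mulVKg.
exfalso.
have EE : mu (vE `|` E) = (mu vE + mu E)%E.
  by rewrite measureU//; apply/seteqP; split=> // x [? ?]; exact: (disj x).
have : (mu (vE `|` E) <= mu U)%E.
  apply: le_measure; rewrite ?inE//; first exact: measurableU.
  move=> x [[_ /vU]|[_ /KU]//]; by rewrite mulVKg.
move: mUb; rewrite EE muvE eE uE -EFinD !lte_fin !lee_fin => H1 H2; clear -b0 e3 H1 H2; lra.
Qed.

(** As long as D is not covered by finitely many translates of K, one more
    translate x O with x in D can be added to a disjoint family inside M: it
    meets y O only if x belongs to y K.  All of them have the measure of O, which
    is positive, so their number is bounded. *)
Lemma packing (D M : set G) (K O : set G) : measurable (M : set (borelType G)) ->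
  (mu M < +oo)%E -> open O -> O 1%g -> compact K ->
  (forall a b, O a -> O b -> K (a * b^-1)%g) ->
  (forall x a, D x -> O a -> M (x * a)%g) ->
  exists2 C, compact C & D `<=` C.
Proof.
move=> mM Moo oO O1 cK OK DM.
have mO := open_borel oO.
have O0 : (0 < mu O)%E by apply: (haar_pos hmu) => //; exists 1%g.
apply: contrapT => nC.
(* C is the union of the n translates of K, S that of the translates of O. *)
have P n : exists C S : set G, [/\ compact C, measurable (S : set (borelType G)), S `<=` M,
    mu S = (n%:R%:E * mu O)%E & forall x a, D x -> ~ C x -> O a -> ~ S (x * a)%g].
  elim: n => [|n [C [S [cC mS SM muS DC]]]].
    exists set0, set0; split=> //; first exact: compact0.
    by rewrite measure0 mul0e.
  have [x [Dx nCx]] : exists x, D x /\ ~ C x.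
    apply: contrapT => /forallNP H; apply: nC; exists C => // x Dx.
    by apply: contrapT => nCx; apply: (H x).
  pose xO : set (borelType G) := [set y : G | O (x^-1 * y)%g].
  have mxO : measurable xO by exact: translate_borel.
  exists (C `|` [set (x * y)%g | y in K]), (S `|` xO); split.
  - apply: compactU => //; apply: continuous_compact => //.
    by apply: continuous_subspaceT; exact: lmulc.
  - exact: measurableU.
  - move=> y [/SM//|xOy]; rewrite -[y](mulVKg x); exact: DM.
  - have dis : S `&` xO = set0.
      apply/seteqP; split => // y [Sy xOy]; apply: (DC x (x^-1 * y)%g) => //.
      by rewrite mulVKg.
    have -> : mu (S `|` xO) = (mu S + mu xO)%E by rewrite measureU.
    rewrite muS [X in (_ + X)%E](_ : _ = mu O); last exact: (haar_left hmu).
    by rewrite -natr1 EFinD ge0_muleDl ?mul1e ?lee_fin.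
  - move=> z a Dz /not_orP[nCz nz] Oa [Sza|/= xza].
      exact: (DC z a).
    apply: nz; exists (x^-1 * z)%g; last by rewrite mulVKg.
    have := OK _ _ xza Oa; by rewrite mulgA mulgK.
have [w [w0 wO]] : exists w : R, 0 < w /\ (w%:E <= mu O)%E.
  case E : (mu O) => [w| |]; rewrite E in O0 => //.
    by exists w; split.
  by exists 1; split=> //; rewrite leey.
have [M' ME] : exists b : R, mu M = b%:E.
  by exists (fine (mu M)); rewrite fineK// ge0_fin_numE.
have M'0 : 0 <= M' by rewrite -lee_fin -ME.
have [n nM] : exists n : nat, M' / w < n%:R.
  by exists (Num.bound (M' / w)); apply: archi_boundP; rewrite divr_ge0// ltW.
have [C [S [_ mS SM muS _]]] := P n.
have : (mu S <= mu M)%E by apply: le_measure; rewrite ?inE.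
rewrite muS ME => H.
have : (n%:R%:E * w%:E <= M'%:E)%E.
  by apply: le_trans H; apply: lee_wpmul2l.
rewrite -EFinM lee_fin leNgt -ltr_pdivrMr//.
by rewrite nM.
Qed.

Lemma open_nbhs_quotient (K : set G) : nbhs (1%g : G) K ->
  exists2 O : set G, open O /\ O 1%g & forall a b, O a -> O b -> K (a * b^-1)%g.
Proof.
move=> nK; have : nbhs ((1 : G) * 1)%g K by rewrite mulg1.
move=> /mulg_near[U [V [U1 V1 UV]]].
have V1' : nbhs (1%g : G) [set x | V (x^-1)%g] by apply: invc; rewrite invg1.
exists (interior (U `&` [set x | V (x^-1)%g])).
  by split; [exact: open_interior|apply: filterI].
by move=> a b /interior_subset[Ua _] /interior_subset[_ Vb]; exact: UV.
Qed.

End HaarGroup.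

(** * The Carnot-Caratheodory gauge and the fundamental solution *)

Lemma compact_bound (T : topologicalType) (R : realType) (f : T -> R) (K : set T) :
  compact K -> (forall x, K x -> {for x, continuous f}) ->
  exists2 M : R, 0 <= M & forall x, K x -> `|f x| <= M.
Proof.
move=> cK fc; have [K0|/set0P/negP/negbNE/eqP ->] := pselect (K !=set0); last by exists 0.
have nc : {within K, continuous (fun x => `|f x|)}.
  apply: continuous_in_subspaceT => x /[!inE] Kx.
  by apply: (@continuous_comp _ _ _ f (fun r : R => `|r|)); [exact: fc|exact: norm_continuous].
have [c cK' H] := compact_EVT_max K0 cK nc.
by exists `|f c| => // x Kx; apply: H; rewrite inE.
Qed.

Lemma powRB1 (R : realType) (a r : R) : 0 < a -> a `^ (r - 1) = a `^ r / a.
Proof.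
move=> a0; rewrite powRB; first by rewrite powRr1// ltW.
by apply/implyP => _; rewrite gt_eqF.
Qed.

(** A closed ball in the image of a chart is carried to a compact
    neighbourhood. *)
Lemma lie_locally_compact (R : realType) d (G : ptopGroupType)
    (A : set (chart R d G)) : lie_group A ->
  exists2 K : set G, compact K & nbhs (1%g : G) K.
Proof.
move=> hG; have [c Ac c1] := lie_cover hG 1%g; have hc := lie_charts hG Ac.
have im1 : chart_im c setT (chart_map c 1%g) by exists 1%g.
have [e e0 eim] : exists2 e : R, 0 < e & closed_ball (chart_map c 1%g) e `<=` chart_im c setT.
  have : nbhs (chart_map c 1%g) (chart_im c setT).
    by apply: open_nbhs_nbhs; split=> //; exact: chart_im_open hc.
  move=> /nbhs_ballP[e /= e0 eim]; exists (e / 2); first by rewrite divr_gt0.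
  by apply: subset_trans eim; apply: closed_ball_subset; rewrite ?divr_gt0// ltr_pdivrMr// ltr_pMr// ltr1n.
have cB : compact (closed_ball (chart_map c 1%g) e).
  apply: bounded_closed_compact; last exact: closed_ball_closed.
  exists (`|chart_map c 1%g| + e); split; first exact: num_real.
  move=> M eM y; rewrite closed_ballE// /closed_ball_/= => ye.
  have -> : y = chart_map c 1%g - (chart_map c 1%g - y) by rewrite subKr.
  apply: le_trans (ler_normB _ _) _.
  by apply: le_trans (ltW eM); rewrite lerD2l.
exists (chart_inv c @` closed_ball (chart_map c 1%g) e).
  apply: continuous_compact => //; apply: continuous_in_subspaceT => p /[!inE] pB.
  by apply: chart_inv_cont hc _ _; exact: eim.
have n1 : \forall x \near (1%g : G), chart_dom c x.
  by apply: open_nbhs_nbhs; split=> //; exact: chart_dom_open hc.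
have n2 : \forall x \near (1%g : G), closed_ball (chart_map c 1%g) e (chart_map c x).
  apply: (chart_map_cont hc c1).
  apply: filterS (nbhsx_ballx (chart_map c 1%g) _ e0).
  exact: subset_closed_ball.
apply: filterS2 n1 n2 => x cx Bx; exists (chart_map c x) => //.
exact: chart_mapK hc _ cx.
Qed.

Section Carnot.
Variables (R : realType) (d : nat) (G : ptopGroupType)
  (A : set (chart R d G)) (hG : lie_group A) (hsc : simply_connected R G)
  (c0 : chart R d G) (hc0 : A c0) (hc01 : chart_dom c0 1%g)
  (m : nat) (V : nat -> {vspace 'rV[R]_d}) (hV : stratification A c0 m V)
  (k : nat) (X : k.-tuple 'rV[R]_d) (hX : basis_of (V 1%N) X)
  (mu : {sigma_finite_measure set (borelType G) -> \bar R})
  (hmu : haar_measure mu)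
  (n : nat) (hn : homogeneous_dimension A c0 mu X n)
  (delta : R -> G -> G) (hdelta : dilations A c0 m V delta).

Local Notation ccd := (cc_dist A c0 X).
Local Notation rho := (cc_norm A c0 X).
Local Notation ball := (cc_ball A c0 X 1%g).

Let mulc : continuous (fun z : G * G => (z.1 * z.2)%g) := (lie_mul hG).1.
Let invc : continuous (fun x : G => (x^-1)%g) := (lie_inv hG).1.

(** Balls are symmetric and multiply as radii add: go to x, then along the
    translate by x y^-1 of a path from y to the neutral element. *)
Lemma ccd_div (r s : R) x y : (ccd 1%g x < r%:E)%E -> (ccd 1%g y < s%:E)%E ->
  (ccd 1%g (x * y^-1)%g < (r + s)%:E)%E.
Proof.
move=> xr /cc_ball_sym /(cc_ball_lmul hG (x * y^-1)%g).
by rewrite mulgVK mulg1 => /(cc_ball_trans xr).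
Qed.

(** The volume bounds give a positive finite measure to the ball of radius
    r / 2, and its quotients lie in the ball of radius r. *)
Lemma cc_ball_nbhs (r : R) : 0 < r -> nbhs (1%g : G) (ball r).
Proof.
move=> r0; have r20 : 0 < r / 2 by rewrite divr_gt0.
have [c c_gt0 /(_ _ r20)[mB lB uB]] := hn.
have := steinhaus (lie_hausdorff hG) mulc hmu mB.
have -> : (0 < mu (ball (r / 2)))%E.
  by apply: lt_le_trans lB; rewrite lte_fin mulr_gt0 ?invr_gt0// exprn_gt0.
have -> : (mu (ball (r / 2)) < +oo)%E by apply: le_lt_trans uB _; rewrite ltry.
move=> /(_ isT isT); apply: filterS => v [x [y [xB yB ->]]].
by rewrite /cc_ball/= (splitr r); exact: ccd_div.
Qed.

(** The points at finite distance form a set that is open and closed, because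
    each ball of radius 1 is a neighbourhood of its centre; it contains any path
    that starts at the neutral element. *)
Lemma ccd_finite x : (ccd 1%g x < +oo)%E.
Proof.
pose H : set G := [set x | (ccd 1%g x < +oo)%E].
have HP y : H y -> exists r : R, (ccd 1%g y < r%:E)%E.
  move=> Hy; exists (fine (ccd 1%g y) + 1); rewrite EFinD fineK; last first.
    by rewrite ge0_fin_numE// cc_dist_ge0.
  by rewrite lteDl// ge0_fin_numE// cc_dist_ge0.
have HQ y (r : R) : (ccd 1%g y < r%:E)%E -> H y by move=> /lt_trans; apply; rewrite ltry.
have near_ball (y : G) : \forall z \near y, ball 1 (y^-1 * z)%g.
  have := @lmul_continuous R d G A hG y^-1%g y (ball 1); apply; rewrite mulVg.
  exact: cc_ball_nbhs.
have oH : open H.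
  rewrite openE => y /HP[r yr]; apply: filterS (near_ball y) => z /=.
  rewrite /cc_ball/= => /(cc_ball_lmul hG y); rewrite mulg1 mulVKg.
  by move=> /(cc_ball_trans yr)/HQ.
have cH : closed H.
  rewrite -[H]setCK; apply: open_closedC; rewrite openE => y nHy.
  apply: filterS (near_ball y) => z /=; rewrite /cc_ball/= => yz /HP[r zr].
  apply: nHy; have := ccd_div zr yz.
  by rewrite invgM invgK mulVKg => /HQ.
have [pc _] := hsc; have [g [gc g0 g1]] := pc 1%g x.
have cn := connected_continuous_connected (@segment_connected R 0 1) gc.
have E : [set g t | t in `[0, 1]] `&` H = [set g t | t in `[0, 1]].
  apply: cn.
  - exists 1%g; split; first by exists 0 => //=; rewrite in_itv/= lexx ler01.
    by apply: (HQ _ 1); have := nbhs_singleton (cc_ball_nbhs ltr01).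
  - by exists H.
  - by exists H.
suff : ([set g t | t in `[0, 1]] `&` H) x by case.
by rewrite E; exists 1 => //=; rewrite in_itv/= lexx ler01.
Qed.

Lemma rhoE x : ccd 1%g x = (rho x)%:E.
Proof. by rewrite /cc_norm fineK// ge0_fin_numE ?ccd_finite// cc_dist_ge0. Qed.

Lemma rho_ballE x (r : R) : (ccd 1%g x < r%:E)%E = (rho x < r).
Proof. by rewrite rhoE lte_fin. Qed.

Lemma rho_ge0 x : 0 <= rho x.
Proof. by rewrite -lee_fin -rhoE cc_dist_ge0. Qed.

Lemma rho_div x y : rho (x * y^-1)%g <= rho x + rho y.
Proof.
apply/ler_addgt0Pr => e e0; apply/ltW.
have -> : rho x + rho y + e = (rho x + e / 2) + (rho y + e / 2) by rewrite addrACA -splitr.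
by rewrite -rho_ballE; apply: ccd_div; rewrite rho_ballE ltrDl divr_gt0.
Qed.

Lemma rho1 : rho 1%g = 0.
Proof.
apply/eqP; rewrite eq_le rho_ge0 andbT; apply/ler_addgt0Pr => e e0; apply/ltW.
by rewrite add0r -rho_ballE; have := nbhs_singleton (cc_ball_nbhs e0).
Qed.

Lemma rhoV x : rho (x^-1)%g = rho x.
Proof.
apply/eqP; rewrite eq_le; apply/andP; split.
  by have := rho_div 1%g x; rewrite rho1 add0r mul1g.
by have := rho_div 1%g x^-1%g; rewrite rho1 add0r mul1g invgK.
Qed.

Lemma rho_ldiv x y : rho (y^-1 * x)%g <= rho x + rho y.
Proof. by have := rho_div y^-1%g x^-1%g; rewrite invgK !rhoV addrC. Qed.

Lemma rho_ldiv_ge x y : rho y - rho x <= rho (y^-1 * x)%g.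
Proof.
rewrite lerBlDl; have := rho_div x (y^-1 * x)%g.
by rewrite invgM invgK mulVKg.
Qed.

Lemma dilation1 (r : R) : 0 < r -> delta r 1%g = 1%g.
Proof.
move=> r0; have := dil_morph hdelta r0 1%g 1%g; rewrite mulg1 => H.
by apply: (mulgI (delta r 1%g)); rewrite mulg1.
Qed.

Lemma dilationK (r : R) x : 0 < r -> delta r (delta r^-1 x) = x.
Proof.
move=> r0; rewrite -(dil_M hdelta)// ?invr_gt0// divff ?gt_eqF//.
exact: (dil_1 hdelta).
Qed.

(** Contraction by the ratio r, then the same for the inverse dilation. *)
Lemma rho_dilation (r : R) x : 0 < r -> rho (delta r x) = r * rho x.
Proof.
have le_dil (s : R) y : 0 < s -> rho (delta s y) <= s * rho y.
  move=> s0; apply/ler_addgt0Pr => e e0; apply/ltW.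
  have -> : s * rho y + e = s * (rho y + e / s) by rewrite mulrDr mulrCA divff ?mulr1// gt_eqF.
  rewrite -rho_ballE -[X in ccd X](dilation1 s0).
  apply: (cc_ball_dilation hG (strat_pos hV) hX hdelta s0).
  by rewrite rho_ballE ltrDl divr_gt0.
move=> r0; apply/eqP; rewrite eq_le le_dil//=.
have := le_dil r^-1 (delta r x); rewrite invr_gt0 => /(_ r0).
rewrite -(dil_M hdelta)// ?invr_gt0// mulVf ?gt_eqF// (dil_1 hdelta).
by rewrite mulrC ler_pdivlMr// mulrC.
Qed.

Lemma measurable_rho : measurable_fun setT (rho : borelType G -> R).
Proof.
have [c c_gt0 hB] := hn.
apply: (measurability _ (RGenInftyO.measurableE R)) => _ /= [_ [r ->] <-].
rewrite setTI; have [r0|r0] := ltP 0 r.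
  have [mB _ _] := hB _ r0; rewrite (_ : _ @^-1` _ = ball r)//.
  by apply/seteqP; split=> x /=; rewrite in_itv/= /cc_ball/= rho_ballE.
rewrite (_ : _ @^-1` _ = set0)//; apply/seteqP; split=> // x /=.
by rewrite in_itv/= => /lt_le_trans/(_ r0); rewrite ltNge rho_ge0.
Qed.

Lemma rho_volume : exists2 c : R, 0 < c & forall r : R, 0 < r ->
  ((c^-1 * r ^+ n)%:E <= mu [set x | (rho x < r)%R])%E /\
  (mu [set x | (rho x < r)%R] <= (c * r ^+ n)%:E)%E.
Proof.
have [c c_gt0 hB] := hn; exists c => // r /hB[_].
by rewrite (_ : ball r = [set x | rho x < r])//; apply/funext => x; rewrite /cc_ball/= rho_ballE.
Qed.

(** Translates x O of a small open set, with x in the ball, lie in the ball of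
    radius r + 1, whose measure is finite. *)
Lemma rho_relatively_compact (r : R) : 0 < r ->
  exists2 C, compact C & [set x | rho x < r] `<=` C.
Proof.
move=> r0; have [K cK K1] := lie_locally_compact hG.
have [Q [hQ Q1] QK] := open_nbhs_quotient mulc invc K1.
have B1 : nbhs (1%g : G) (ball 1) by exact: cc_ball_nbhs.
have [c c_gt0 hB] := hn.
have r10 : 0 < r + 1 by rewrite addr_gt0.
have [mB _ uB] := hB _ r10.
apply: (packing mulc hmu (M := ball (r + 1)) (K := K)
  (O := Q `&` interior (ball 1))) => //.
- by apply: le_lt_trans uB _; rewrite ltry.
- by apply: openI => //; exact: open_interior.
- by move=> a b [Qa _] [Qb _]; exact: QK.
- move=> x a /= xr [_ /interior_subset]; rewrite /cc_ball/= !rho_ballE => a1.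
  have := rho_div x a^-1%g; rewrite invgK rhoV => /le_lt_trans; apply.
  by rewrite ltrD.
Qed.

Lemma compact_rho_bounded (K : set G) : compact K ->
  exists M : R, forall x, K x -> rho x < M.
Proof.
move=> /compact_near_coveringP cK.
have := cK R +oo%R (fun M x => rho x < M) _; case=> [x Kx|M [_ H]].
  have nb : \forall z \near x, ball 1 (x^-1 * z)%g.
    have := @lmul_continuous R d G A hG x^-1%g x (ball 1); apply; rewrite mulVg; exact: cc_ball_nbhs.
  exists ([set z | ball 1 (x^-1 * z)%g], [set M | rho x + 1 < M]) => /=.
    by split => //; apply: nbhs_pinfty_gt; exact: num_real.
  move=> [z M] /= []; rewrite /cc_ball/= rho_ballE => xz xM.
  apply: lt_trans xM; rewrite -[z](mulVKg x).
  have := rho_div x (x^-1 * z)^-1%g; rewrite invgK rhoV => /le_lt_trans; apply.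
  by rewrite ltrD2l.
by exists (M + 1) => x Kx; apply: H => //=; rewrite ltrDl.
Qed.

Lemma open_off1 : open (~` [set (1%g : G)]).
Proof.
apply: closed_openC; apply: accessible_closed_set1.
exact: hausdorff_accessible (lie_hausdorff hG).
Qed.

(** Part of a compact set containing the ball of radius 2, from which the
    interior of the unit ball, a neighbourhood of the neutral element, is
    removed. *)
Lemma unit_sphere : exists2 K : set G, compact K &
  (forall x, rho x = 1 -> K x) /\ ~ K 1%g.
Proof.
have [C cC HC] := rho_relatively_compact (r := 2) ltac:(by []).
exists (C `&` ~` interior (ball 1)).
  by apply: compact_closedI => //; apply: open_closedC; exact: open_interior.
split=> [x x1|[_ H]]; last by apply: H; exact: cc_ball_nbhs.
split; first by apply: HC; rewrite /= x1 ltr1n.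
by move=> /interior_subset; rewrite /cc_ball/= rho_ballE x1 ltxx.
Qed.

(** Derivatives at x along a left-invariant field involve only points x p with p
    near the neutral element; if x differs from it, so do these points, and the
    homogeneity and the positivity of Gamma may be used on them. *)
Lemma near_translate_off1 x : x != 1%g ->
  \forall p \near chart_map c0 1%g, (x * chart_inv c0 p)%g != 1%g.
Proof.
move=> x1; have c0c := lie_charts hG hc0.
have cc : {for chart_map c0 1%g, continuous (fun p => (x * chart_inv c0 p)%g)}.
  apply: (@continuous_comp _ _ _ (chart_inv c0) (fun y => (x * y)%g)).
    by apply: (chart_inv_cont c0c); exists 1%g.
  exact: (@lmul_continuous R d G A hG x _).
have nb : \forall p \near chart_map c0 1%g, (~` [set (1%g : G)]) (x * chart_inv c0 p)%g.
  apply: cc; apply: open_nbhs_nbhs; split; first exact: open_off1.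
  by rewrite (chart_mapK c0c hc01) mulg1; exact/eqP.
by apply: filterS nb => p /eqP.
Qed.

Variable (Gamma : G -> R).
Hypothesis (hGamma : fundamental_solution A c0 mu X delta n Gamma).
Hypothesis (hn3 : (3 <= n)%N).

Local Notation beta := ((2 - n%:R)^-1 : R).
Local Notation N := (hom_norm n Gamma).

Lemma exponent_lt0 : 2 - n%:R < 0 :> R.
Proof. by rewrite subr_lt0 ltr_nat. Qed.

Lemma dilation_neq1 (r : R) x : 0 < r -> x != 1%g -> delta r x != 1%g.
Proof.
move=> r0; apply: contra_neq => rx1.
have r10 : 0 < r^-1 by rewrite invr_gt0.
have := dilationK x r10; rewrite invrK rx1 => <-.
by rewrite dilation1.
Qed.

Lemma Gamma_continuous x : x != 1%g -> {for x, continuous Gamma}.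
Proof.
move=> /eqP x1; apply: (smooth_on_continuous hG open_off1) => //.
exact: fs_smooth hGamma.
Qed.

(** Differentiate the homogeneity relation of degree 2 - n: a horizontal
    derivative lowers the degree by one. *)
Lemma lfield_Gamma_dilation v (r : R) x : v \in V 1%N -> 0 < r -> x != 1%g ->
  lfield c0 v Gamma (delta r x) = r `^ (1 - n%:R) * lfield c0 v Gamma x.
Proof.
move=> vV r0 x1; have rx1 := dilation_neq1 r0 x1.
have := dil_diff hdelta r0 (j := 1%N) _ vV open_off1 (fs_smooth hGamma) (x := x).
rewrite (strat_pos hV) expr1 => /(_ isT (elimN eqP rx1)) E.
have nE : lfield c0 v (fun y => Gamma (delta r y)) x = r `^ (2 - n%:R) * lfield c0 v Gamma x.
  have [_ dG] := lfield_regular hG hc0 hc01 v open_off1 (elimN eqP x1) (fs_smooth hGamma).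
  rewrite /lfield -deriveMl//; apply: near_eq_derive.
  have c0c := lie_charts hG hc0.
  apply: filterS (near_translate_off1 x1) => p p1 /=.
  by rewrite (fs_homog hGamma).
apply: (mulfI (lt0r_neq0 r0)); rewrite -E nE mulrA; congr (_ * _).
have -> : 1 - n%:R = 2 - n%:R - 1 :> R by lra.
by rewrite powRB1// mulrCA divff ?mulr1// gt_eqF.
Qed.

(** Chain rule for N = Gamma^beta along the line through x. *)
Lemma lfield_hom_norm v x : x != 1%g ->
  lfield c0 v N x = beta * Gamma x `^ (beta - 1) * lfield c0 v Gamma x.
Proof.
move=> x1; have c0c := lie_charts hG hc0.
have [_ dG] := lfield_regular hG hc0 hc01 v open_off1 (elimN eqP x1) (fs_smooth hGamma).
pose F (p : 'rV[R]_d) := Gamma (x * chart_inv c0 p)%g.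
have F1 : F (chart_map c0 1%g) = Gamma x by rewrite /F (chart_mapK c0c hc01) mulg1.
have nE : lfield c0 v N x = 'D_v (fun p => F p `^ beta) (chart_map c0 1%g).
  rewrite /lfield; apply: near_eq_derive.
  apply: filterS (near_translate_off1 x1) => p p1 /=.
  by rewrite /hom_norm (negbTE p1).
rewrite nE derive_line; pose f (t : R) := F (t *: v + chart_map c0 1%g).
have fd : derivable f 0 1 by exact: (derivable1P _ _ _).1 dG.
have f0 : f 0 = Gamma x by rewrite /f scale0r add0r F1.
have G0 : 0 < f 0 by rewrite f0 (fs_pos hGamma).
have pd := is_derive1_powR beta G0.
rewrite -derive1E -[LHS]/(derive1 ((fun r => r `^ beta) \o f) 0) derive1_comp//.
rewrite derive1E derive_val f0; congr (_ * _).
by rewrite derive1E -derive_line.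
Qed.

Lemma hgrad_hom_norm x : x != 1%g ->
  hgrad_norm c0 X N x / `|N x| = `|beta| * (hgrad_norm c0 X Gamma x / Gamma x).
Proof.
move=> x1; have G0 := fs_pos hGamma x1.
rewrite /hgrad_norm.
under eq_bigr => i _ do rewrite lfield_hom_norm// normrM exprMn.
rewrite -mulr_sumr sqrtrM ?sqr_ge0// sqrtr_sqr normr_id normrM.
rewrite /hom_norm (negbTE x1) !(ger0_norm (powR_ge0 _ _)) -!mulrA; congr (_ * _).
rewrite mulrCA; congr (_ * _).
rewrite powRB1//.
by field; rewrite !gt_eqF ?powR_gt0.
Qed.

(** Gamma, 1 / Gamma and the horizontal derivatives of Gamma are continuous away
    from the neutral element, hence bounded on the compact set that contains the
    unit sphere. *)
Lemma Gamma_bounds : exists g1 g2 M : R, [/\ 0 < g1, 0 < g2, 0 <= M &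
  forall x, rho x = 1 -> [/\ g1 <= Gamma x, Gamma x <= g2 & hgrad_norm c0 X Gamma x <= M]].
Proof.
have [K cK [KS K1]] := unit_sphere.
have off1 x : K x -> x != 1%g by move=> Kx; apply/eqP => x1; apply: K1; rewrite -x1.
have [g2 g20 G2] := compact_bound cK (fun x Kx => Gamma_continuous (off1 x Kx)).
have [g1 g10 G1] : exists2 M : R, 0 <= M & forall x, K x -> `|(Gamma x)^-1| <= M.
  apply: compact_bound => // x Kx; apply: cvgV; last exact: Gamma_continuous (off1 _ Kx).
  by rewrite gt_eqF// (fs_pos hGamma)// off1.
have /choice[M HM] : forall i : 'I_k, exists M : R, 0 <= M /\
    forall x, K x -> `|lfield c0 (tnth X i) Gamma x| <= M.
  move=> i; have [|M M0 HM] := @compact_bound _ R (lfield c0 (tnth X i) Gamma) K cK.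
    move=> x /off1/eqP x1.
    by have [] := lfield_regular hG hc0 hc01 (tnth X i) open_off1 x1 (fs_smooth hGamma).
  by exists M.
exists (g1 + 1)^-1, (g2 + 1), (Num.sqrt (\sum_i M i ^+ 2)); split => //.
- by rewrite invr_gt0 ltr_wpDl.
- by rewrite ltr_wpDl.
- move=> x /KS Kx; have G0 := fs_pos hGamma (off1 _ Kx); split.
  + rewrite invf_ple ?posrE//; last by rewrite ltr_wpDl.
    have := G1 _ Kx; rewrite ger0_norm ?invr_ge0 ?(ltW G0)// => /le_trans; apply.
    by rewrite lerDl.
  + have := G2 _ Kx; rewrite gtr0_norm// => /le_trans; apply.
    by rewrite lerDl.
  + rewrite /hgrad_norm ler_sqrt ?sumr_ge0// => [|i _]; last exact: sqr_ge0.
    apply: ler_sum => i _; rewrite ler_sqr ?nnegrE//; first exact: (HM i).2.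
    exact: (HM i).1.
Qed.

(** Polar coordinates: x is the dilation by rho(x) of a point of the unit
    sphere. *)
Lemma rho_normalize x : 0 < rho x ->
  exists w, [/\ rho w = 1, x = delta (rho x) w & w != 1%g].
Proof.
move=> r0; exists (delta (rho x)^-1 x).
have w1 : rho (delta (rho x)^-1 x) = 1.
  by rewrite rho_dilation ?invr_gt0// mulVf// gt_eqF.
split => //; first by rewrite dilationK.
by apply/eqP => E; move: w1; rewrite E rho1 => /esym/eqP; rewrite oner_eq0.
Qed.

(** By homogeneity N(x) / rho(x) and rho(x) |grad N(x)| / N(x) depend only on the
    projection of x to the unit sphere, where [Gamma_bounds] applies. *)
Lemma hom_norm_bounds : exists a b M : R, [/\ 0 < a, 0 < b, 0 <= M &
  forall x, 0 < rho x -> [/\ a * rho x <= N x, N x <= b * rho x &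
    hgrad_norm c0 X N x / `|N x| <= M / rho x]].
Proof.
have [g1 [g2 [M [g10 g20 M0 H]]]] := Gamma_bounds.
have b0 : beta <= 0 by rewrite invr_le0 ltW// exponent_lt0.
exists (g2 `^ beta), (g1 `^ beta), (`|beta| * (M / g1)); split.
- exact: powR_gt0.
- exact: powR_gt0.
- by rewrite mulr_ge0// divr_ge0// ltW.
move=> x r0; have [w [w1 xE wn1]] := rho_normalize r0.
have [G1 G2 GM] := H _ w1; have Gw0 := fs_pos hGamma wn1.
have xn1 : x != 1%g by rewrite xE dilation_neq1.
have NE : N x = rho x * Gamma w `^ beta.
  rewrite /hom_norm (negbTE xn1) {1}xE (fs_homog hGamma)// powRM ?powR_ge0 ?(ltW Gw0)//.
  by rewrite -powRrM divff ?powRr1// ?(ltW r0)// lt_eqF// exponent_lt0.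
have npow a b : 0 < a -> a <= b -> b `^ beta <= a `^ beta.
  move=> a0 ab; have b'0 := lt_le_trans a0 ab.
  rewrite -[beta]opprK !(powRN _ (- beta)) lef_pV2 ?posrE ?powR_gt0//.
  by apply: ge0_ler_powR; rewrite ?nnegrE ?oppr_ge0// ltW.
split.
- by rewrite NE mulrC ler_pM2l// npow.
- by rewrite NE mulrC ler_pM2r// npow.
rewrite hgrad_hom_norm// -!mulrA ler_wpM2l//.
rewrite xE /hgrad_norm.
under eq_bigr => i _ do rewrite lfield_Gamma_dilation ?(basis_mem hX) ?mem_tnth// normrM exprMn.
rewrite -mulr_sumr sqrtrM ?sqr_ge0// sqrtr_sqr normr_id -/(hgrad_norm c0 X Gamma w).
rewrite (fs_homog hGamma)// rho_dilation// w1 mulr1 ger0_norm ?powR_ge0//.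
have -> : rho x `^ (1 - n%:R) = rho x `^ (2 - n%:R) / rho x.
  by rewrite -powRB1//; congr (_ `^ _); lra.
have p0 : 0 < rho x `^ (2 - n%:R) by exact: powR_gt0.
rewrite [leLHS](_ : _ = hgrad_norm c0 X Gamma w / Gamma w / rho x); last first.
  by field; rewrite !gt_eqF.
rewrite mulrA ler_pM2r ?invr_gt0// ler_pM// ?sqrtr_ge0 ?invr_ge0 ?(ltW Gw0)//.
by rewrite lef_pV2.
Qed.

End Carnot.

(** * A Hardy inequality on a space with volumes of power growth *)

Section IntegralTools.
Context d (T : measurableType d) (R : realType).
Variable mu : {measure set T -> \bar R}.

(** The integral of a non-negative function is a supremum over simple functions,
    which makes it monotone without measurability.  This allows to bound the
    integrals that involve N and its gradient through pointwise estimates. *)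
Lemma integral_mono (f g : T -> \bar R) :
  (forall x, 0 <= f x)%E -> (forall x, f x <= g x)%E ->
  (\int[mu]_x f x <= \int[mu]_x g x)%E.
Proof.
move=> f0 fg; have g0 x : (0 <= g x)%E by apply: le_trans (fg x).
rewrite !ge0_integralTE//; apply: ereal_sup_le => _ [h hf <-].
by exists h => // x; exact: le_trans (fg x).
Qed.

Lemma measurable_le_set (f g : T -> R) : measurable_fun setT f ->
  measurable_fun setT g -> measurable [set x | f x <= g x].
Proof.
move=> mf mg; have mgf := measurable_funB mg mf.
rewrite (_ : [set _ | _] = setT `&` (g \- f) @^-1` `[0, +oo[%classic).
  by apply: mgf => //; exact: measurable_itv.
by rewrite setTI; apply/seteqP; split=> x /=; rewrite in_itv/= andbT subr_ge0.
Qed.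

Lemma measurable_lt_set (f g : T -> R) : measurable_fun setT f ->
  measurable_fun setT g -> measurable [set x | f x < g x].
Proof.
move=> mf mg; rewrite (_ : [set _ | _] = ~` [set x | g x <= f x]).
  by apply: measurableC; exact: measurable_le_set.
by apply/seteqP; split=> x /=; rewrite ltNge => /negP.
Qed.

End IntegralTools.

(** The factor is the sum of the bounds for the two signs of the exponent. *)
Lemma powR_compare (R : realType) (r th q x : R) : 0 < r -> 0 < x -> 1 <= th ->
  r / th <= x -> x <= r -> x `^ q <= (1 + th `^ (- q)) * r `^ q.
Proof.
move=> r0 x0 th1 rx xr; have th0 : 0 < th by exact: lt_le_trans th1.
rewrite mulrDl mul1r; have [q0|q0] := leP 0 q.
  apply: (@le_trans _ _ (r `^ q)).
    by apply: ge0_ler_powR; rewrite ?nnegrE// ltW.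
  by rewrite lerDl mulr_ge0// powR_ge0.
apply: (@le_trans _ _ (th `^ (- q) * r `^ q)); last by rewrite lerDr powR_ge0.
have -> : th `^ (- q) * r `^ q = (r / th) `^ q.
  rewrite powRM ?invr_ge0 ?(ltW r0) ?(ltW th0)// mulrC; congr (_ * _).
  by rewrite -powR_inv1 ?(ltW th0)// -powRrM mulN1r.
rewrite -[q]opprK !(powRN _ (- q)) lef_pV2 ?posrE ?powR_gt0 ?divr_gt0//.
by apply: ge0_ler_powR; rewrite ?nnegrE ?oppr_ge0 ?divr_ge0// ltW.
Qed.

Lemma zero_set_negligible d (T : measurableType d) (R : realType)
    (mu : {measure set T -> \bar R}) (rho : T -> R) (p c : R) :
  measurable_fun setT rho -> (forall x, 0 <= rho x) -> 0 < p -> 0 < c ->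
  (forall r : R, 0 < r -> (mu [set x | (rho x < r)%R] <= (c * r `^ p)%:E)%E) ->
  measurable [set x | rho x = 0] /\ mu [set x | rho x = 0] = 0%E.
Proof.
move=> mrho rho0 p0 c0 vle.
have mZ : measurable [set x | rho x = 0].
  rewrite (_ : [set _ | _] = [set x | rho x <= 0]).
    by apply: measurable_le_set => //; exact: measurable_cst.
  apply/seteqP; split=> x /=; first by move=> ->.
  by move=> x0; apply/eqP; rewrite eq_le x0 rho0.
split=> //; apply/eqP; rewrite eq_le measure_ge0 andbT.
apply/lee_addgt0Pr => e e0; rewrite add0e.
have ec0 : 0 < e / c by rewrite divr_gt0.
have r0 : 0 < (e / c) `^ p^-1 by exact: powR_gt0.
apply: (@le_trans _ _ (mu [set x | (rho x < (e / c) `^ p^-1)%R])).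
  apply: le_measure; rewrite ?inE//; last by move=> x /= ->.
  by apply: measurable_lt_set => //; exact: measurable_cst.
apply: le_trans (vle _ r0) _; rewrite lee_fin -powRrM mulVf ?gt_eqF//.
by rewrite powRr1 ?(ltW ec0)// mulrC divfK// gt_eqF.
Qed.

Lemma regroup (R : realType) (k c t C0 A B U x y : R) : C0 = k * c * t -> A * B = 1 ->
  U * (k * x) * (c * (t * y)) = C0 * A * (U * (B * (x * y))).
Proof.
move=> -> AB; transitivity ((A * B) * (U * (k * x) * (c * (t * y)))).
  by rewrite AB mul1r.
by ring.
Qed.

Section AnnularHardy.
Context d (T : measurableType d) (R : realType).
Variables (mu : {sigma_finite_measure set T -> \bar R}) (rho : T -> R).
Hypotheses (mrho : measurable_fun setT rho) (rho0 : forall x, 0 <= rho x).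
Variables (p a c : R).
Hypotheses (p0 : 0 < p) (c0 : 0 < c) (pa0 : 0 < p + a).
Hypothesis vol_ge : forall r : R, 0 < r ->
  ((c^-1 * r `^ p)%:E <= mu [set x | (rho x < r)%R])%E.
Hypothesis vol_le : forall r : R, 0 < r ->
  (mu [set x | (rho x < r)%R] <= (c * r `^ p)%:E)%E.

(** The ratio between the radii of a shell.  By the choice of its p-th power, the
    lower bound of the volume of the outer ball exceeds the upper bound of that
    of the inner one by at least r^p; see [annulus_volume]. *)
Definition shell_ratio : R := (c * (c + 1) + 1) `^ p^-1.
Local Notation th := shell_ratio.
(** The constant of [annular_upper]: the weight rho(x)^(a - p) is compared with
    that of the outer radius of a shell of ratio th, and the volume is that of a
    ball of twice this radius. *)
Definition swap_const : R := (1 + th `^ (- (a - p))) * c * 2 `^ p.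
Local Notation C0 := swap_const.
(** How much farther than x the points y are taken.  By this choice
    la^p >= 4 C0 la^(- a), so that the term in u(y)^2 is absorbed. *)
Definition shell_gap : R := (1 + 4 * C0) `^ (p + a)^-1.
Local Notation la := shell_gap.

Definition outside (e : R) := [set x | e <= rho x].

Definition annular_pairs (e : R) :=
  [set z : T * T | [/\ e <= rho z.1, la * rho z.1 <= rho z.2 &
                       rho z.2 < th * la * rho z.1]].

Let cc1 : 1 <= c * (c + 1) + 1.
Proof. by rewrite lerDr mulr_ge0// ?addr_ge0// ltW. Qed.

Let th_ge1 : 1 <= th.
Proof.
rewrite /shell_ratio; have {1}-> : (1 : R) = 1 `^ p^-1 by rewrite powR1.
by apply: ge0_ler_powR; rewrite ?nnegrE ?invr_ge0 ?(ltW p0) ?ler01 ?(le_trans ler01 cc1).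
Qed.

Let th_gt0 : 0 < th. Proof. exact: lt_le_trans th_ge1. Qed.

Let thp : th `^ p = c * (c + 1) + 1.
Proof. by rewrite /shell_ratio -powRrM mulVf ?gt_eqF// powRr1// (le_trans ler01 cc1). Qed.

Let C0_gt0 : 0 < C0.
Proof. by rewrite !mulr_gt0// ?powR_gt0// ltr_pwDl// powR_ge0. Qed.

Let la_ge1 : 1 <= la.
Proof.
have C01 : 1 <= 1 + 4 * C0 by rewrite lerDl mulr_ge0// ltW.
rewrite /shell_gap; have {1}-> : (1 : R) = 1 `^ (p + a)^-1 by rewrite powR1.
by apply: ge0_ler_powR; rewrite ?nnegrE ?invr_ge0 ?(ltW pa0) ?ler01 ?(le_trans ler01 C01).
Qed.

Let lapa : la `^ (p + a) = 1 + 4 * C0.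
Proof.
by rewrite /shell_gap -powRrM mulVf ?gt_eqF// powRr1// addr_ge0// mulr_ge0// ltW.
Qed.

Lemma shell_gap_gt1 : 1 < la.
Proof.
rewrite lt_neqAle la_ge1 andbT; apply/eqP => E; have := lapa.
by rewrite -E powR1 => /eqP; rewrite eq_sym addrC -subr_eq0 addrK mulf_eq0 pnatr_eq0/= gt_eqF.
Qed.

Let la_gt0 : 0 < la. Proof. exact: lt_le_trans la_ge1. Qed.

(** The volume bounds have different constants, so a shell may be negligible
    unless the ratio of its radii is large. *)
Lemma annulus_volume (r : R) : 0 < r ->
  ((r `^ p)%:E <= mu [set y | (r <= rho y)%R /\ (rho y < th * r)%R])%E.
Proof.
move=> r0; have thr0 : 0 < th * r by rewrite mulr_gt0.
pose B s := [set y | rho y < s].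
have mB s : measurable (B s) by apply: measurable_lt_set => //; exact: measurable_cst.
set S := [set y | _]; have mS : measurable S.
  rewrite (_ : S = [set y | r <= rho y] `&` B (th * r)) //.
  by apply: measurableI => //; apply: measurable_le_set => //; exact: measurable_cst.
have BE : B (th * r) = B r `|` S.
  apply/seteqP; split=> y /=; rewrite /B/=.
    by move=> yt; have [|] := ltP (rho y) r; [left|right].
  by move=> [yr|[_]//]; apply: lt_le_trans yr _; rewrite ler_peMl ?(ltW r0) ?th_ge1.
have H : (mu (B (th * r)%R) <= mu (B r) + mu S)%E by rewrite BE; exact: measureU2.
have := le_trans (vol_ge thr0) (le_trans H (leeD2r (mu S) (vol_le r0))).
rewrite powRM ?(ltW th_gt0) ?(ltW r0)// thp => H2.
have := measure_ge0 mu S; move: H2; case: (mu S) => [v| |]; last by [].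
  rewrite -EFinD !lee_fin => H2 _.
  have rp : 0 <= r `^ p by exact: powR_ge0.
  have E : c^-1 * ((c * (c + 1) + 1) * r `^ p) = c * r `^ p + r `^ p + c^-1 * r `^ p.
    by field; rewrite gt_eqF.
  rewrite E in H2.
  have : 0 <= c^-1 * r `^ p by rewrite mulr_ge0// invr_ge0 ltW.
  lra.
by move=> *; rewrite leey.
Qed.

Variables (u : T -> R) (um : measurable_fun setT u) (e : R) (e0 : 0 < e).

Let q := a - p.

Lemma measurable_outside : measurable (outside e).
Proof. by apply: measurable_le_set => //; exact: measurable_cst. Qed.

Let mrho1 : measurable_fun setT (fun z : T * T => rho z.1).
Proof. exact: (measurableT_comp mrho measurable_fst). Qed.

Let mrho2 : measurable_fun setT (fun z : T * T => rho z.2).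
Proof. exact: (measurableT_comp mrho measurable_snd). Qed.

Lemma measurable_annular_pairs : measurable (annular_pairs e).
Proof.
rewrite (_ : annular_pairs e = [set z | e <= rho z.1] `&`
  ([set z | la * rho z.1 <= rho z.2] `&` [set z | rho z.2 < th * la * rho z.1])); last first.
  by apply/seteqP; split=> z /= []; [split|move=> ? []; split].
apply: measurableI; first by apply: measurable_le_set => //; exact: measurable_cst.
apply: measurableI.
  by apply: measurable_le_set => //; apply: measurable_funM => //; exact: measurable_cst.
by apply: measurable_lt_set => //; apply: measurable_funM => //; exact: measurable_cst.
Qed.

Let weight_fst : measurable_fun setT (fun z : T * T => rho z.1 `^ q).
Proof. exact: (measurableT_comp (measurable_powR q) mrho1). Qed.

Let u_fst : measurable_fun setT (fun z : T * T => u z.1).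
Proof. exact: (measurableT_comp um measurable_fst). Qed.

Let u_snd : measurable_fun setT (fun z : T * T => u z.2).
Proof. exact: (measurableT_comp um measurable_snd). Qed.

Let mg : measurable_fun setT (fun x => (u x ^+ 2 * rho x `^ a)%:E).
Proof.
apply/measurable_EFinP; apply: measurable_funM; first exact: measurable_funX.
exact: (measurableT_comp (measurable_powR a) mrho).
Qed.

(** Integrate first in y: for fixed x the admissible y fill a shell of inner
    radius la rho(x), of volume at least (la rho(x))^p. *)
Lemma annular_lower :
  ((la `^ p)%:E * \int[mu]_(x in outside e) (u x ^+ 2 * rho x `^ a)%:E <=
   \int[(mu \x mu)%E]_(z in annular_pairs e) (u z.1 ^+ 2 * rho z.1 `^ q)%:E)%E.
Proof.
have mA := measurable_annular_pairs; have mO := measurable_outside.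
rewrite [leRHS]integral_mkcond [X in (_ * X)%E]integral_mkcond.
set F := _ \_ (annular_pairs e); set g := _ \_ (outside e).
have mF : measurable_fun setT F.
  apply/(measurable_restrictT _ mA); apply: measurable_funTS.
  apply/measurable_EFinP; apply: measurable_funM => //; exact: measurable_funX.
have F0 z : (0 <= F z)%E.
  by apply: erestrict_ge0 => ? _; rewrite lee_fin mulr_ge0// ?sqr_ge0 ?powR_ge0.
have g0 x : (0 <= g x)%E.
  by apply: erestrict_ge0 => ? _; rewrite lee_fin mulr_ge0// ?sqr_ge0 ?powR_ge0.
have mg' : measurable_fun setT g.
  by apply/(measurable_restrictT _ mO); exact: measurable_funTS.
rewrite fubini_tonelli1// -ge0_integralZl//; last by rewrite lee_fin powR_ge0.
apply: ge0_le_integral => //.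
- by move=> x _; rewrite mule_ge0// lee_fin powR_ge0.
- exact: measurable_funeM.
- exact: measurable_fun_fubini_tonelli_F.
move=> x _; rewrite /fubini_F /g patchE; case: ifPn => xO; last first.
  by rewrite mule0; apply: integral_ge0.
have {xO} xe : e <= rho x by move: xO; rewrite inE.
have rx0 : 0 < rho x := lt_le_trans e0 xe.
have lr0 : 0 < la * rho x by rewrite mulr_gt0.
pose S := [set y | la * rho x <= rho y /\ rho y < th * (la * rho x)].
have mS : measurable S.
  rewrite (_ : S = [set y | la * rho x <= rho y] `&` [set y | rho y < th * (la * rho x)]) //.
  apply: measurableI; [apply: measurable_le_set => //|apply: measurable_lt_set => //];
    exact: measurable_cst.
have -> : (fun y => F (x, y)) = (cst (u x ^+ 2 * rho x `^ q)%:E) \_ S.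
  apply/funext => y; rewrite /F !patchE.
  rewrite (_ : ((x, y) \in annular_pairs e) = (y \in S))//.
  apply/idP/idP; rewrite !inE /annular_pairs /S /= mulrA; first by case.
  by case.
rewrite -integral_mkcond integral_cst//.
apply: (@le_trans _ _ ((u x ^+ 2 * rho x `^ q)%:E * ((la * rho x) `^ p)%:E)%E).
  rewrite -!EFinM lee_fin powRM ?(ltW la_gt0) ?(ltW rx0)//.
  have -> : a = q + p by rewrite /q subrK.
  rewrite powRD; last by apply/implyP => _; rewrite gt_eqF.
  by rewrite le_eqVlt; apply/orP; left; apply/eqP; ring.
apply: lee_wpmul2l; first by rewrite lee_fin mulr_ge0 ?sqr_ge0 ?powR_ge0.
exact: annulus_volume.
Qed.

(** Integrate first in x: for fixed y the admissible x have rho(x) between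
    rho(y) / (th la) and rho(y) / la, so their weights are comparable with
    (rho(y) / la)^(a - p) and their volume is at most a constant times
    (rho(y) / la)^p. *)
Lemma annular_upper :
  (\int[(mu \x mu)%E]_(z in annular_pairs e) (u z.2 ^+ 2 * rho z.1 `^ q)%:E <=
   (C0 * la `^ (- a))%:E * \int[mu]_(x in outside e) (u x ^+ 2 * rho x `^ a)%:E)%E.
Proof.
have mA := measurable_annular_pairs; have mO := measurable_outside.
rewrite [leLHS]integral_mkcond [X in (_ * X)%E]integral_mkcond.
set F := _ \_ (annular_pairs e); set g := _ \_ (outside e).
have mF : measurable_fun setT F.
  apply/(measurable_restrictT _ mA); apply: measurable_funTS.
  apply/measurable_EFinP; apply: measurable_funM => //; exact: measurable_funX.
have F0 z : (0 <= F z)%E.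
  by apply: erestrict_ge0 => ? _; rewrite lee_fin mulr_ge0// ?sqr_ge0 ?powR_ge0.
have g0 x : (0 <= g x)%E.
  by apply: erestrict_ge0 => ? _; rewrite lee_fin mulr_ge0// ?sqr_ge0 ?powR_ge0.
have mg' : measurable_fun setT g.
  by apply/(measurable_restrictT _ mO); exact: measurable_funTS.
have K0 : (0 <= (C0 * la `^ (- a))%:E)%E by rewrite lee_fin mulr_ge0 ?powR_ge0// ltW.
rewrite fubini_tonelli2// -ge0_integralZl//.
apply: ge0_le_integral => //.
- by move=> y _; apply: integral_ge0.
- exact: measurable_fun_fubini_tonelli_G.
- exact: measurable_funeM.
move=> y _; rewrite /fubini_G /g patchE; case: ifPn => yO; last first.
  rewrite mule0; rewrite integral0_eq// => x _; rewrite /F patchE; case: ifPn => // .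
  rewrite inE => -[/= ex xy _]; move: yO; rewrite notin_setE /outside/= => nye.
  exfalso; apply: nye; apply: (le_trans ex); apply: le_trans xy.
  by rewrite ler_peMl// (le_trans (ltW e0)).
have {yO} ye : e <= rho y by move: yO; rewrite inE.
have ry0 : 0 < rho y := lt_le_trans e0 ye.
pose r := rho y / la; have r0 : 0 < r by rewrite divr_gt0.
pose S := [set x | rho x < 2 * r].
have mS : measurable S by apply: measurable_lt_set => //; exact: measurable_cst.
pose K := u y ^+ 2 * ((1 + th `^ (- q)) * r `^ q).
have K'0 : 0 <= K.
  apply: mulr_ge0; first exact: sqr_ge0.
  by apply: mulr_ge0; [apply: addr_ge0 => //; exact: powR_ge0|exact: powR_ge0].
apply: (@le_trans _ _ (\int[mu]_x ((cst K%:E) \_ S) x)%E).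
  apply: integral_mono => // x; rewrite /F !patchE; case: ifPn => xA; last first.
    by case: ifPn => //= _; rewrite lee_fin.
  move: xA; rewrite inE => -[/= ex xy yx].
  have rx0 := lt_le_trans e0 ex.
  have xr : rho x <= r by rewrite /r ler_pdivlMr// mulrC.
  rewrite mem_set; last by rewrite /S/= (le_lt_trans xr)// ltr_pMl// ltr1n.
  rewrite lee_fin ler_wpM2l ?sqr_ge0//; apply: powR_compare => //.
  rewrite /r ler_pdivrMr// ler_pdivrMr// ltW//.
  by rewrite (lt_le_trans yx)// le_eqVlt; apply/orP; left; apply/eqP; ring.
rewrite -integral_mkcond integral_cst//.
have r20 : 0 < 2 * r by rewrite mulr_gt0.
apply: (@le_trans _ _ (K%:E * (c * (2 * r) `^ p)%:E)%E).
  by apply: lee_wpmul2l; [rewrite lee_fin|exact: vol_le].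
rewrite -!EFinM lee_fin powRM ?(ltW r0)// le_eqVlt; apply/orP; left; apply/eqP.
have -> : rho y `^ a = la `^ a * (r `^ q * r `^ p).
  rewrite -powRD; last by apply/implyP => _; rewrite gt_eqF.
  rewrite /q subrK -powRM ?(ltW la_gt0) ?(ltW r0)//; congr (_ `^ _).
  by rewrite /r mulrC divfK// gt_eqF.
apply: regroup; first by [].
rewrite -powRD ?addNr ?powRr0//; by apply/implyP => _; rewrite gt_eqF.
Qed.

(** Integrate u(x)^2 <= 2 u(y)^2 + 2 (u(x) - u(y))^2 over the pairs.  The energy
    must be finite for its absorption to be legitimate, whence the truncation
    to rho >= e. *)
Theorem annular_hardy_truncated :
  (\int[mu]_(x in outside e) (u x ^+ 2 * rho x `^ a)%:E < +oo)%E ->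
  (\int[mu]_(x in outside e) (u x ^+ 2 * rho x `^ a)%:E <=
   4%:E * \int[(mu \x mu)%E]_(z in annular_pairs e)
     ((u z.1 - u z.2) ^+ 2 * rho z.1 `^ q)%:E)%E.
Proof.
set J := (\int[mu]_(x in _) _)%E; set D := (\int[_]_(z in _) _)%E => Joo.
have J0 : (0 <= J)%E.
  by apply: integral_ge0 => x _; rewrite lee_fin mulr_ge0// ?sqr_ge0 ?powR_ge0.
have D0 : (0 <= D)%E.
  by apply: integral_ge0 => x _; rewrite lee_fin mulr_ge0// ?sqr_ge0 ?powR_ge0.
have mA := measurable_annular_pairs.
pose F2 (z : T * T) := (u z.2 ^+ 2 * rho z.1 `^ q)%:E.
pose F3 (z : T * T) := ((u z.1 - u z.2) ^+ 2 * rho z.1 `^ q)%:E.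
have mF2 : measurable_fun (annular_pairs e) F2.
  apply: measurable_funTS; apply/measurable_EFinP; apply: measurable_funM => //.
  exact: measurable_funX.
have mF3 : measurable_fun (annular_pairs e) F3.
  apply: measurable_funTS; apply/measurable_EFinP; apply: measurable_funM => //.
  by apply: measurable_funX; exact: measurable_funB.
have F20 z : (0 <= F2 z)%E by rewrite lee_fin mulr_ge0// ?sqr_ge0 ?powR_ge0.
have F30 z : (0 <= F3 z)%E by rewrite lee_fin mulr_ge0// ?sqr_ge0 ?powR_ge0.
have H1 := annular_lower; have H2 := annular_upper; rewrite -/J in H1 H2.
have H3 : (\int[(mu \x mu)%E]_(z in annular_pairs e) (u z.1 ^+ 2 * rho z.1 `^ q)%:E <=
    2%:E * \int[(mu \x mu)%E]_(z in annular_pairs e) F2 z + 2%:E * D)%E.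
  have E2 : (\int[(mu \x mu)%E]_(z in annular_pairs e) (2%:E * F2 z) =
      2%:E * \int[(mu \x mu)%E]_(z in annular_pairs e) F2 z)%E by rewrite ge0_integralZl.
  have E3 : (\int[(mu \x mu)%E]_(z in annular_pairs e) (2%:E * F3 z) = 2%:E * D)%E.
    by rewrite ge0_integralZl.
  rewrite -E2 -E3 -ge0_integralD//; last 4 first.
  - by move=> z _; rewrite mule_ge0.
  - exact: measurable_funeM.
  - by move=> z _; rewrite mule_ge0.
  - exact: measurable_funeM.
  apply: ge0_le_integral => //.
  - by move=> z _; rewrite lee_fin mulr_ge0// ?sqr_ge0 ?powR_ge0.
  - apply: measurable_funTS; apply/measurable_EFinP; apply: measurable_funM => //.
    exact: measurable_funX.
  - by apply: emeasurable_funD; exact: measurable_funeM.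
  move=> z _; rewrite /F2 /F3 -!EFinM -EFinD lee_fin !mulrA -mulrDl.
  rewrite ler_wpM2r ?powR_ge0//.
  (* 2 y^2 + 2 (x - y)^2 - x^2 = (x - 2 y)^2. *)
  have : 0 <= (u z.1 - 2 * u z.2) ^+ 2 by exact: sqr_ge0.
  by rewrite -subr_ge0; congr (0 <= _); ring.
have [Doo|] := ltP D +oo%E; last first.
  by rewrite leye_eq => /eqP ->; rewrite gt0_muley ?leey// lte_fin.
have [j jE] : exists j : R, J = j%:E by exists (fine J); rewrite fineK// ge0_fin_numE.
have [v vE] : exists v : R, D = v%:E by exists (fine D); rewrite fineK// ge0_fin_numE.
have j0 : 0 <= j by rewrite -lee_fin -jE.
have v0 : 0 <= v by rewrite -lee_fin -vE.
have : ((la `^ p)%:E * J <= 2%:E * ((C0 * la `^ (- a))%:E * J) + 2%:E * D)%E.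
  apply: le_trans H1 (le_trans H3 _); apply: leeD2r; exact: lee_wpmul2l.
rewrite jE vE -!EFinM -EFinD !lee_fin => H.
have lap1 : 1 <= la `^ p.
  have {1}-> : (1 : R) = 1 `^ p by rewrite powR1.
  by apply: ge0_ler_powR; rewrite ?nnegrE// ?(ltW p0) ?(ltW la_gt0).
have K4 : 4 * (C0 * la `^ (- a)) <= la `^ p.
  have E : la `^ p * la `^ a = 1 + 4 * C0.
    by rewrite -powRD ?lapa//; apply/implyP => _; rewrite gt_eqF.
  by rewrite (powRN la a) mulrA (ler_pdivrMr _ _ (powR_gt0 a la_gt0)) E lerDr.
have : 4 * (C0 * la `^ (- a)) * j <= la `^ p * j by rewrite ler_wpM2r.
have : j <= la `^ p * j by rewrite ler_peMl.
move: H; set X := la `^ p * j; set Y := C0 * la `^ (- a); lra.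
Qed.

End AnnularHardy.

(** A Hardy inequality for every non-negative function rho whose sublevel sets
    have a volume comparable with r^p.  The ratios la and La depend on the
    constants only; monotone convergence removes the truncation. *)
Theorem annular_hardy d (T : measurableType d) (R : realType)
    (mu : {sigma_finite_measure set T -> \bar R}) (rho : T -> R) (p a c : R) :
  measurable_fun setT rho -> (forall x, 0 <= rho x) ->
  0 < p -> 0 < c -> 0 < p + a ->
  (forall r : R, 0 < r -> ((c^-1 * r `^ p)%:E <= mu [set x | (rho x < r)%R])%E) ->
  (forall r : R, 0 < r -> (mu [set x | (rho x < r)%R] <= (c * r `^ p)%:E)%E) ->
  exists la La : R, 1 < la /\ forall u : T -> R, measurable_fun setT u ->
    (forall e, 0 < e -> (\int[mu]_(x in outside rho e) (u x ^+ 2 * rho x `^ a)%:E < +oo)%E) ->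
    (\int[mu]_(x in [set x | (0 < rho x)%R]) (u x ^+ 2 * rho x `^ a)%:E <=
     4%:E * \int[(mu \x mu)%E]_(z in [set z | [/\ (0 < rho z.1)%R,
        (la * rho z.1 <= rho z.2)%R & (rho z.2 < La * rho z.1)%R]])
       ((u z.1 - u z.2) ^+ 2 * rho z.1 `^ (a - p))%:E)%E.
Proof.
move=> mrho rho0 p0 c0 pa0 vge vle.
exists (shell_gap p a c), (shell_ratio p c * shell_gap p a c); split.
  exact: shell_gap_gt1.
move=> u um fin.
pose F j := outside rho (j.+1%:R^-1 : R).
have mF j : measurable (F j) by exact: measurable_outside.
have mg : measurable_fun setT (fun x => (u x ^+ 2 * rho x `^ a)%:E).
  apply/measurable_EFinP; apply: measurable_funM; first exact: measurable_funX.
  exact: (measurableT_comp (measurable_powR a) mrho).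
have UF : \bigcup_j F j = [set x | 0 < rho x].
  apply/seteqP; split=> x /=.
    by move=> [j _]; rewrite /F /outside/=; apply: lt_le_trans; rewrite invr_gt0.
  move=> x0; exists (Num.bound (rho x)^-1) => //; rewrite /F /outside/=.
  rewrite invf_ple ?posrE//; apply: ltW.
  apply: lt_le_trans (archi_boundP _) _; first by rewrite invr_ge0.
  by rewrite ler_nat.
have nF : nondecreasing_seq F.
  move=> i j ij; rewrite subsetEset => x; rewrite /F /outside/=; apply: le_trans.
  by rewrite lef_pV2 ?posrE// ler_nat.
have cv := @ge0_nondecreasing_set_cvg_integral _ T R F
  (fun x => (u x ^+ 2 * rho x `^ a)%:E) mu nF mF
  (fun i => measurable_funTS mg)
  (fun i x _ => mulr_ge0 (sqr_ge0 (u x)) (powR_ge0 (rho x) a)).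
rewrite -UF -(cvg_lim _ cv)//; apply: lime_le; first by apply/cvg_ex; eexists; exact: cv.
near=> j; have j0 : 0 < (j.+1%:R^-1 : R) by rewrite invr_gt0.
apply: le_trans (annular_hardy_truncated mrho rho0 p0 c0 pa0 vge vle um j0 (fin _ j0)) _.
apply: lee_wpmul2l; first by rewrite lee_fin.
have mrho1 : measurable_fun setT (fun z : T * T => rho z.1).
  exact: (measurableT_comp mrho measurable_fst).
have mrho2 : measurable_fun setT (fun z : T * T => rho z.2).
  exact: (measurableT_comp mrho measurable_snd).
apply: ge0_subset_integral => //.
- exact: measurable_annular_pairs.
- rewrite (_ : [set z | _] = [set z : T * T | 0 < rho z.1] `&`
    ([set z | shell_gap p a c * rho z.1 <= rho z.2] `&`
     [set z | rho z.2 < shell_ratio p c * shell_gap p a c * rho z.1])); last first.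
    by apply/seteqP; split=> z /= []; [split|move=> ? []; split].
  apply: measurableI; first by apply: measurable_lt_set => //; exact: measurable_cst.
  apply: measurableI.
    by apply: measurable_le_set => //; apply: measurable_funM => //; exact: measurable_cst.
  by apply: measurable_lt_set => //; apply: measurable_funM => //; exact: measurable_cst.
- apply: measurable_funTS; apply/measurable_EFinP; apply: measurable_funM.
    apply: measurable_funX; apply: measurable_funB.
      exact: (measurableT_comp um measurable_fst).
    exact: (measurableT_comp um measurable_snd).
  exact: (measurableT_comp (measurable_powR (a - p)) mrho1).
- by move=> z _; rewrite lee_fin mulr_ge0// ?sqr_ge0 ?powR_ge0.
- by move=> z [jz ? ?]; split => //; exact: lt_le_trans jz.
Unshelve. all: by end_near. Qed.

(** * The weighted fractional Hardy inequality *)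

Section Scale.
Context d (T : measurableType d) (R : realType).
Variable mu : {measure set T -> \bar R}.
Import HBNNSimple.

(** Holds for functions that are not known to be measurable, such as the
    integrand with N in it: divide the simple functions below K f by K. *)
Lemma integral_scale_le (f : T -> \bar R) (K : R) : 0 < K ->
  (forall x, 0 <= f x)%E ->
  (\int[mu]_x (K%:E * f x) <= K%:E * \int[mu]_x f x)%E.
Proof.
move=> K0 f0; rewrite [leLHS]ge0_integralTE; last first.
  by move=> x; rewrite mule_ge0// lee_fin ltW.
apply: ge_ereal_sup => _ [h /= hf <-].
have K0' : 0 <= K^-1 by rewrite invr_ge0 ltW.
have -> : sintegral mu h = (K%:E * \int[mu]_x (K^-1 * h x)%:E)%E.
  rewrite -ge0_integralZl//.
  - rewrite -integralT_nnsfun; apply: eq_integral => x _ /=.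
    by rewrite -EFinM mulrA divff ?mul1r// gt_eqF.
  - by apply/measurable_EFinP; exact: measurable_funM.
  - by move=> x _; rewrite lee_fin mulr_ge0.
  - by rewrite lee_fin ltW.
apply: lee_wpmul2l; first by rewrite lee_fin ltW.
apply: integral_mono => x; first by rewrite lee_fin mulr_ge0.
rewrite EFinM; have := lee_wpmul2l (x := K^-1%:E) _ (hf x).
rewrite lee_fin => /(_ K0')/le_trans; apply.
by rewrite muleA -EFinM mulVf ?mul1e// gt_eqF.
Qed.

End Scale.

Lemma powR_sandwich (R : realType) (a b x y r : R) : 0 < a -> 0 < b -> 0 < x ->
  a * x <= y -> y <= b * x -> y `^ r <= (a `^ r + b `^ r) * x `^ r.
Proof.
move=> a0 b0 x0 axy ybx; have y0 : 0 < y by apply: lt_le_trans axy; rewrite mulr_gt0.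
have ax0 : 0 < a * x by rewrite mulr_gt0.
rewrite mulrDl -!powRM ?(ltW a0) ?(ltW b0) ?(ltW x0)//; have [r0|r0] := leP 0 r.
  apply: (@le_trans _ _ ((b * x) `^ r)); last by rewrite lerDr powR_ge0.
  by apply: ge0_ler_powR; rewrite ?nnegrE// ?ltW// mulr_gt0.
apply: (@le_trans _ _ ((a * x) `^ r)); last by rewrite lerDl powR_ge0.
rewrite -[r]opprK !(powRN _ (- r)) lef_pV2 ?posrE ?powR_gt0//.
by apply: ge0_ler_powR; rewrite ?nnegrE ?oppr_ge0// ltW.
Qed.

Lemma continuous_borel_real (R : realType) (G : ptopGroupType) (u : G -> R) :
  continuous u -> measurable_fun setT (u : borelType G -> R).
Proof.
move=> uc; apply: (measurability _ (RGenOpens.measurableE R)).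
move=> _ [_ [a [b ->] <-]]; rewrite setTI; apply: open_borel.
by move/continuousP : uc; apply; exact: interval_open.
Qed.

Theorem theorem1p1 (R : realType) (d : nat) (G : ptopGroupType)
  (A : set (chart R d G)) (hG : lie_group A) (hsc : simply_connected R G)
  (c0 : chart R d G) (hc0 : A c0) (hc01 : chart_dom c0 1%g)
  (m : nat) (V : nat -> {vspace 'rV[R]_d}) (hV : stratification A c0 m V)
  (k : nat) (X : k.-tuple 'rV[R]_d) (hX : basis_of (V 1%N) X)
  (mu : {sigma_finite_measure set (borelType G) -> \bar R})
  (hmu : haar_measure mu)
  (n : nat) (hn : homogeneous_dimension A c0 mu X n) (hn3 : (3 <= n)%N)
  (delta : R -> G -> G) (hdelta : dilations A c0 m V delta)
  (Gamma : G -> R) (hGamma : fundamental_solution A c0 mu X delta n Gamma)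
  (alpha s : R) (halpha : 2 - n%:R < alpha) (hs0 : 0 < s) (hs1 : s < 1) :
  let N := hom_norm n Gamma in
  exists2 C : R, 0 < C & forall u : G -> R, test_fun_off1 A u ->
    (\int[mu]_x
        (u x ^+ 2 * (hgrad_norm c0 X N x / `|N x|) `^ s * N x `^ alpha)%:E
     <= C%:E * \int[(mu \x mu)%E]_z
        (`|u z.1 - u z.2| ^+ 2 / cc_norm A c0 X (z.2^-1 * z.1)%g `^ (n%:R + s)
           * N z.1 `^ alpha)%:E)%E.
Proof.
move=> N.
pose rho : borelType G -> R := cc_norm A c0 X.
have mrho : measurable_fun setT rho by exact: (measurable_rho hG hsc hmu hn).
have rho0 x : 0 <= rho x by exact: (rho_ge0 hG hsc hmu hn).
have [c c_gt0 vol] := rho_volume hG hsc hmu hn.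
have [a1 [b1 [M [a10 b10 M0 NB]]]] :=
  hom_norm_bounds hG hsc hc0 hc01 hV hX hmu hn hdelta hGamma hn3.
pose a := alpha - s.
have n0 : 0 < n%:R :> R by rewrite ltr0n (leq_trans _ hn3).
have na : 0 < n%:R + a by rewrite /a; lra.
have vge (r : R) : 0 < r -> ((c^-1 * r `^ n%:R)%:E <= mu [set x | (rho x < r)%R])%E.
  by move=> r0; rewrite powR_mulrn ?(ltW r0)//; exact: (vol r r0).1.
have vle (r : R) : 0 < r -> (mu [set x | (rho x < r)%R] <= (c * r `^ n%:R)%:E)%E.
  by move=> r0; rewrite powR_mulrn ?(ltW r0)//; exact: (vol r r0).2.
have [la [La [la1 H]]] := annular_hardy mrho rho0 n0 c_gt0 na vge vle.
(* The sums of two powers bound a power whose base lies between two multiples of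
   another one, whatever the sign of the exponent. *)
pose K1 := M `^ s * (a1 `^ alpha + b1 `^ alpha).
pose K2 := (1 + `|La|) `^ (n%:R + s) * (b1^-1 `^ alpha + a1^-1 `^ alpha).
have K10 : 0 <= K1 by rewrite mulr_ge0 ?powR_ge0// addr_ge0 ?powR_ge0.
have K20 : 0 < K2.
  apply: mulr_gt0; first by apply: powR_gt0; rewrite ltr_pwDl.
  by apply: addr_gt0; apply: powR_gt0; rewrite invr_gt0.
have K11 : 0 < K1 + 1 by rewrite ltr_wpDl.
(* K1 vanishes when M does; adding 1 makes the constant positive. *)
exists ((K1 + 1) * 4 * K2); first by apply: mulr_gt0 => //; apply: mulr_gt0.
move=> u [[uS uK] _].
have uc : continuous u.
  by move=> x; apply: (smooth_on_continuous hG (W := setT)) => //; exact: openT.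
have um : measurable_fun setT (u : borelType G -> R) by exact: continuous_borel_real.
have [B B0 uB] := compact_bound uK (fun x _ => uc x).
have [S0 KS] := compact_rho_bounded hG hsc hmu hn uK.
(* The maximum with 1 makes the radius positive even if the support of u is empty. *)
pose S := Num.max S0 1.
have S1 : 0 < S by rewrite lt_max ltr01 orbT.
have uS0 x : u x != 0 -> rho x < S.
  by move=> ux; rewrite lt_max KS//; exact: subset_closure.
have uB' x : u x ^+ 2 <= B ^+ 2.
  have [->|ux] := eqVneq (u x) 0; first by rewrite expr0n sqr_ge0.
  rewrite -real_normK ?num_real// ler_sqr ?nnegrE//.
  by apply: uB; exact: subset_closure.
have mg : measurable_fun setT (fun x : borelType G => (u x ^+ 2 * rho x `^ a)%:E).
  apply/measurable_EFinP; apply: measurable_funM; first exact: measurable_funX.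
  exact: (measurableT_comp (measurable_powR a) mrho).
have g0 x : (0 <= (u x ^+ 2 * rho x `^ a)%:E)%E.
  by rewrite lee_fin mulr_ge0 ?sqr_ge0 ?powR_ge0.
have mSet : measurable [set x : borelType G | rho x < S].
  by apply: measurable_lt_set => //; exact: measurable_cst.
(* Off a ball around the neutral element u is bounded and lives where rho lies
   between two positive constants. *)
have fin e : 0 < e -> (\int[mu]_(x in outside rho e) (u x ^+ 2 * rho x `^ a)%:E < +oo)%E.
  move=> e0; pose C := B ^+ 2 * ((e `^ a + S `^ a) * 1 `^ a).
  have C0 : 0 <= C.
    by rewrite mulr_ge0 ?sqr_ge0// mulr_ge0 ?powR_ge0// addr_ge0 ?powR_ge0.
  apply: (@le_lt_trans _ _ (\int[mu]_(x in [set x : borelType G | (rho x < S)%R]) C%:E)%E).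
    rewrite integral_mkcond [leRHS]integral_mkcond; apply: integral_mono => x.
      by apply: erestrict_ge0 => ? _; exact: g0.
    rewrite !patchE; case: ifPn => [|_]; last first.
      by case: ifPn => //= _; rewrite lee_fin.
    rewrite inE /outside/= => ex; case: ifPn => [|].
      rewrite inE/= => xS; rewrite lee_fin ler_pM ?sqr_ge0 ?powR_ge0//.
      by apply: powR_sandwich; rewrite ?mulr1// ltW.
    rewrite notin_setE/= => xS; have [->|/uS0//] := eqVneq (u x) 0.
    by rewrite expr0n mul0r.
  rewrite integral_cst//.
  apply: (@le_lt_trans _ _ (C%:E * (c * S `^ n%:R)%:E)%E).
    by apply: lee_wpmul2l; [rewrite lee_fin|exact: vle].
  by rewrite -EFinM ltry.
have {}H := H u um fin.
have [mZ null] := zero_set_negligible mrho rho0 n0 c_gt0 vle.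
pose P := [set x : borelType G | 0 < rho x].
have mP : measurable P by apply: measurable_lt_set => //; exact: measurable_cst.
pose f x := (u x ^+ 2 * (hgrad_norm c0 X N x / `|N x|) `^ s * N x `^ alpha)%:E.
(* The infinite value on the null set rho = 0, where the gradient of N is not
   controlled, makes h a measurable bound of f everywhere. *)
pose h (x : borelType G) : \bar R :=
  if (0 < rho x)%R then (K1%:E * (u x ^+ 2 * rho x `^ a)%:E)%E else +oo%E.
have LHS : (\int[mu]_x f x <= K1%:E * \int[mu]_(x in P) (u x ^+ 2 * rho x `^ a)%:E)%E.
  have f0 x : (0 <= f x)%E.
    rewrite lee_fin; apply: mulr_ge0; last exact: powR_ge0.
    by apply: mulr_ge0; [exact: sqr_ge0|exact: powR_ge0].
  have mh : measurable_fun setT h.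
    apply: measurable_fun_ifT.
    - by apply: measurable_fun_ltr => //; exact: measurable_cst.
    - exact: measurable_funeM.
    - exact: measurable_cst.
  apply: (@le_trans _ _ (\int[mu]_x h x)%E).
    apply: integral_mono => // x; rewrite /f /h; case: ifPn => [r0|_]; last by rewrite leey.
    have [N1 N2 N3] := NB x r0.
    rewrite -EFinM lee_fin mulrCA -mulrA ler_wpM2l ?sqr_ge0//.
    apply: (@le_trans _ _ ((M / rho x) `^ s * ((a1 `^ alpha + b1 `^ alpha) * rho x `^ alpha))).
      apply: ler_pM; rewrite ?powR_ge0//; last exact: powR_sandwich.
      apply: ge0_ler_powR; rewrite ?nnegrE ?(ltW hs0)//.
        by rewrite divr_ge0 ?sqrtr_ge0.
      by rewrite divr_ge0.
    rewrite powRM ?invr_ge0// /a powRB; last by apply/implyP => _; rewrite gt_eqF.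
    rewrite -powR_inv1// -powRrM mulN1r powRN /K1.
    by rewrite le_eqVlt; apply/orP; left; apply/eqP; ring.
  rewrite (ge0_negligible_integral _ _ _ _ null)//; last first.
  - move=> x _; rewrite /h; case: ifPn => _; last by rewrite leey.
    by rewrite mule_ge0// lee_fin.
  rewrite (_ : _ `\` _ = P); last first.
    apply/seteqP; split=> x /=; first by move=> [_ /eqP rx]; rewrite /P/= lt_neqAle eq_sym rx rho0.
    by rewrite /P/= => r0; split => // r00; rewrite r00 ltxx in r0.
  rewrite -ge0_integralZl//; last exact: measurable_funTS.
  by rewrite (@eq_integral _ _ _ _ _ h)// => x; rewrite inE /P/= /h => ->.
pose F (z : borelType G * borelType G) := (`|u z.1 - u z.2| ^+ 2 /
  cc_norm A c0 X (z.2^-1 * z.1)%g `^ (n%:R + s) * N z.1 `^ alpha)%:E.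
have F0 z : (0 <= F z)%E.
  by rewrite lee_fin mulr_ge0 ?powR_ge0// divr_ge0 ?sqr_ge0 ?powR_ge0.
have RHS : (\int[(mu \x mu)%E]_(z in [set z | [/\ (0 < rho z.1)%R,
        (la * rho z.1 <= rho z.2)%R & (rho z.2 < La * rho z.1)%R]])
       ((u z.1 - u z.2) ^+ 2 * rho z.1 `^ (a - n%:R))%:E <=
     K2%:E * \int[(mu \x mu)%E]_z F z)%E.
  apply: le_trans (integral_scale_le _ K20 F0); rewrite [leLHS]integral_mkcond.
  apply: integral_mono => z.
    by apply: erestrict_ge0 => ? _; rewrite lee_fin mulr_ge0 ?sqr_ge0 ?powR_ge0.
  rewrite patchE; case: ifPn => [|_]; last by rewrite mule_ge0// lee_fin ltW.
  case: z => x y; rewrite inE /F/= => -[rx xy yx].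
  have [N1 N2 _] := NB x rx.
  have N0 : 0 < N x by apply: lt_le_trans N1; rewrite mulr_gt0.
  pose w := cc_norm A c0 X (y^-1 * x)%g.
  have w1 : w <= (1 + `|La|) * rho x.
    apply: le_trans (rho_ldiv hG hsc hmu hn x y) _; rewrite mulrDl mul1r lerD2l.
    by apply: le_trans (ltW yx) _; rewrite ler_wpM2r// ler_norm.
  have w0 : 0 < w.
    apply: lt_le_trans (rho_ldiv_ge hG hsc hmu hn x y).
    by rewrite subr_gt0 (lt_le_trans _ xy)// ltr_pMl.
  rewrite -EFinM lee_fin -/w real_normK ?num_real//.
  have U0 : 0 <= (u x - u y) ^+ 2 by exact: sqr_ge0.
  set U := (u x - u y) ^+ 2 in U0 *.
  have -> : K2 * (U / w `^ (n%:R + s) * N x `^ alpha) =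
      U * (K2 * (N x `^ alpha / w `^ (n%:R + s))) by ring.
  rewrite ler_wpM2l//.
  have -> : rho x `^ (a - n%:R) = rho x `^ (- (n%:R + s)) * rho x `^ alpha.
    by rewrite -powRD; [congr (_ `^ _); rewrite /a; ring|apply/implyP => _; rewrite gt_eqF].
  apply: (@le_trans _ _ (((1 + `|La|) `^ (n%:R + s) / w `^ (n%:R + s)) *
    ((b1^-1 `^ alpha + a1^-1 `^ alpha) * N x `^ alpha))); last first.
    by rewrite le_eqVlt; apply/orP; left; apply/eqP; rewrite /K2; ring.
  apply: ler_pM; rewrite ?powR_ge0//; last first.
    apply: powR_sandwich; rewrite ?invr_gt0//.
      by rewrite mulrC ler_pdivrMr// mulrC.
    by rewrite mulrC ler_pdivlMr// mulrC.
  rewrite powRN ler_pdivlMr ?powR_gt0// mulrC ler_pdivrMr ?powR_gt0//.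
  have L0 : 0 <= 1 + `|La| by rewrite addr_ge0.
  rewrite -powRM ?(ltW rx)//; apply: ge0_ler_powR; rewrite ?nnegrE ?(ltW w0)//.
    by rewrite addr_ge0 ?(ltW n0) ?(ltW hs0).
  by rewrite mulr_ge0 ?(ltW rx).
apply: (le_trans LHS).
apply: (@le_trans _ _ ((K1 + 1)%:E * (4%:E * (K2%:E * \int[(mu \x mu)%E]_z F z)))%E).
  apply: lee_pmul; first by rewrite lee_fin.
  - by apply: integral_ge0 => x _; exact: g0.
  - by rewrite lee_fin lerDl.
  - by apply: (le_trans H); apply: lee_wpmul2l; rewrite ?lee_fin.
by rewrite !muleA -!EFinM.
Qed.
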